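(* For $c>1$ consider the symmetric moment problem given by $b_n(c)=c^c(n+1)^c$, $n\ge0$, and let $s_{2n}(c)$, $c_n(c)$ denote the corresponding even moments and numbers $c_n$. Then the series $\sum_{n} c_{2n}(c)s_{2n}(c)$ is convergent for $c>3/2$ and divergent for $1<c<3/2$; i.e. property (cs) holds for $c>3/2$, but not for $1<c<3/2$.
   Context: Given positive numbers $(b_n)_{n\ge0}$, let $P_{-1}=0$, $P_0=1$ and $xP_n(x)=b_nP_{n+1}(x)+b_{n-1}P_{n-1}(x)$, $n\ge0$ (the value of $b_{-1}$ is irrelevant). There is a probability measure $\mu$ on $\mathbb{R}$ with infinite support and all moments for which $(P_n)$ are the orthonormal polynomials; its moments $s_n=\int x^n\,d\mu$ depend only on $(b_n)$. The associated Hamburger moment problem is the symmetric moment problem given by $(b_n)$; it is indeterminate if more than one measure has the moments $(s_n)$. For $b_n=c^c(n+1)^c$ with $c>1$ it is known to be indeterminate. Write $P_n(x)=\sum_{k=0}^n b_{k,n}x^k$. In the indeterminate case put $c_k=\big(\sum_{n=k}^\infty b_{k,n}^2\big)^{1/2}<\infty$. Property (cs): $\sum_{n=0}^\infty c_{2n}s_{2n}<\infty$. *)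

(* Defs.v *)
From HB Require Import structures.
From mathcomp Require Import all_boot all_order all_algebra.
From mathcomp Require Import all_classical all_reals all_analysis.

Set Implicit Arguments.
Unset Strict Implicit.
Unset Printing Implicit Defensive.

Import Order.TTheory GRing.Theory Num.Theory.
Import numFieldTopology.Exports numFieldNormedType.Exports.

Local Open Scope classical_set_scope.
Local Open Scope ring_scope.

(* P_0 = 1 and x P_n = b_n P_{n+1} + b_{n-1} P_{n-1}, solved for P_{n+1}; the
   inner match is the term b_{n-1} P_{n-1}, which is 0 for n = 0. *)
Fixpoint orthopoly (R : fieldType) (b : nat -> R) (n : nat) : {poly R} :=
  if n is k.+1 then
    (b k)^-1 *: ('X * orthopoly b k
                 - (if k is m.+1 then b m *: orthopoly b m else 0))
  else 1.

Lemma orthopolyP (R : fieldType) (b : nat -> R) : (forall n, b n != 0) ->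
  [/\ orthopoly b 0 = 1,
      'X * orthopoly b 0 = b 0%N *: orthopoly b 1 &
      forall n, 'X * orthopoly b n.+1 =
                b n.+1 *: orthopoly b n.+2 + b n *: orthopoly b n].
Proof.
move=> b0; split=> [//||n].
- by rewrite [orthopoly b 1]/= subr0 scalerA mulfV// scale1r.
- rewrite -[orthopoly b n.+2]/((b n.+1)^-1 *:
    ('X * orthopoly b n.+1 - b n *: orthopoly b n)).
  by rewrite scalerA mulfV// scale1r subrK.
Qed.

Definition measure_support (R : realType)
    (mu : {measure set (measurableTypeR R) -> \bar R}) : set R :=
  [set x | forall U : set R, open U -> U x -> (0 < mu U)%E].

Definition moment (R : realType)
    (mu : {measure set (measurableTypeR R) -> \bar R}) (n : nat) : R :=
  Rintegral mu setT (fun x : R => x ^+ n).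

(* mu solves the symmetric moment problem given by b: it has infinite support,
   all moments, and (P_n) as its orthonormal polynomials. *)
Record solves_moment_problem (R : realType) (b : nat -> R)
    (mu : probability (measurableTypeR R) R) : Prop := SolvesMomentProblem {
  smp_support : infinite_set (measure_support mu) ;
  smp_moments : forall n : nat,
    mu.-integrable setT (fun x : R => (x ^+ n)%:E) ;
  smp_orthonormal : forall m n : nat,
    Rintegral mu setT (fun x : R => (orthopoly b m).[x] * (orthopoly b n).[x])
    = (m == n)%:R }.

(* c_k = (\sum_(n >= k) b_{k,n}^2)^(1/2), where b_{k,n} is the coefficient of
   x^k in P_n.  The limit is meaningful only when the series converges, which
   holds for every k when the moment problem is indeterminate. *)
Definition coef_norm (R : realType) (b : nat -> R) (k : nat) : R :=
  Num.sqrt (limn (fun N => \sum_(k <= n < N) ((orthopoly b n)`_k) ^+ 2)).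

(* The terms are nonnegative, so convergence means that the sum is finite. *)
Definition property_cs (R : realType) (b : nat -> R)
    (mu : {measure set (measurableTypeR R) -> \bar R}) : Prop :=
  cvgn (series (fun n => coef_norm b n.*2 * moment mu n.*2)).

Definition power_coef (R : realType) (c : R) (n : nat) : R :=
  c `^ c * (n.+1%:R) `^ c.

(* Main.v *)
Require Import Defs.
From mathcomp Require Import all_boot all_order all_algebra.
From mathcomp Require Import all_classical all_reals all_analysis.
From mathcomp Require Import measurable_realfun.
From mathcomp Require Import ring lra zify.

(* Let q_n(x) = |P_n(i x)|, and write x = 2 T^c.  Solutions of the recursions
   for q_n(x) and for P_n(x) in the range 2 b_n <= x are positive, and comparing
   them with products of the fixpoints e^(theta_j) of the frozen recursions
   (x = 2 b_j sinh(theta_j), resp. x = 2 b_j cosh(theta_j)) gives, up to factors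
   e^(o(T)), sup_n q_n(x) = e^(T K) and sup_n |P_n(x)| = e^(T I), where
     K = int_0^oo du / sqrt(1 + u^(2c)),   I = int_0^1 du / sqrt(1 - u^(2c)).
   The oscillatory range 2 b_n > x contributes nothing, because the quadratic
   form [energy] divided by b_n^2 - x^2/4 is nonincreasing there.

   On the other hand Phi(x) = sum_k c_2k x^(2k) is at least sup_m q_2m(x) and at
   most e^(T (K + o(1))), and property (cs) says that Phi is mu-integrable.
   Since int P_n^2 dmu = 1:
   - if K < 2 I, then Phi(x) <= C sum_n w^n P_n(x)^2 for some w < 1, so Phi is
     integrable;
   - if K > 2 I, then P_n^2 <= C Phi for all n; as P_n -> 0 pointwise, dominated
     convergence would give 1 = int P_n^2 dmu -> 0 if Phi were integrable.

   For c = 3/2, K = 2 I follows from doubling on the curve y^2 = x^3 + 1.  For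
   general c the same substitution, conjugated by powers of u, multiplies the
   integrand by the power 3/(2c) - 1 of a factor >= 2, so that K <= 2 lambda^-1 I
   or K >= 2 lambda^-1 I with lambda = 2^(1 - 3/(2c)), according to the sign
   of c - 3/2. *)

Set Implicit Arguments.
Unset Strict Implicit.
Unset Printing Implicit Defensive.

Import Order.TTheory GRing.Theory Num.Theory.
Import numFieldTopology.Exports numFieldNormedType.Exports.

Local Open Scope classical_set_scope.
Local Open Scope ring_scope.

(** * Growth rates of three-term recursions *)

Section Rate.
Variable R : rcfType.
Implicit Types s b y x : R.

(* The positive root r = e^theta of b r^2 = y r + s b (the larger root if
   s = -1): y = 2 b sinh theta for s = 1 and y = 2 b cosh theta for s = -1. *)
Definition rate s b y := (y + Num.sqrt (y ^+ 2 + s * (4 * b ^+ 2))) / (2 * b).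

Lemma rate_gt0 s b y : 0 < b -> 0 < y -> 0 < rate s b y.
Proof.
by move=> b0 y0; rewrite divr_gt0 ?mulr_gt0// ltr_wpDr ?sqrtr_ge0.
Qed.

Lemma mul_rate s b y : 0 < b ->
  b * rate s b y = (y + Num.sqrt (y ^+ 2 + s * (4 * b ^+ 2))) / 2.
Proof. by move=> b0; rewrite /rate; field; rewrite gt_eqF. Qed.

Lemma rate_fixpoint s b y : 0 < b -> 0 < y -> 0 <= y ^+ 2 + s * (4 * b ^+ 2) ->
  b * rate s b y = y + s * b / rate s b y.
Proof.
move=> b0 y0 d0; have r0 := rate_gt0 s b0 y0.
have rn0 : rate s b y != 0 by rewrite gt_eqF.
apply: (mulIf rn0); rewrite mulrDl divfK// /rate.
set q := Num.sqrt _.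
have qq : q ^+ 2 = y ^+ 2 + s * (4 * b ^+ 2) by rewrite sqr_sqrtr.
apply/eqP; rewrite -subr_eq0; apply/eqP.
transitivity ((q ^+ 2 - (y ^+ 2 + s * (4 * b ^+ 2))) / (4 * b)); last first.
  by rewrite qq subrr mul0r.
by field; rewrite gt_eqF.
Qed.

(** The fixpoints, scaled by b, move monotonically with b, and in opposite directions for the two
    signs s. All inductions that compare solutions with products of rates rest on this. *)
Lemma ler_mul_rate b b' y : 0 < b -> b <= b' -> b * rate 1 b y <= b' * rate 1 b' y.
Proof.
move=> b0 bb'; have b'0 := lt_le_trans b0 bb'.
rewrite !mul_rate// ler_pM2r ?invr_gt0// lerD2l ler_wsqrtr// !mul1r lerD2l ler_pM2l//.
by rewrite ler_pXn2r// nnegrE ltW.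
Qed.

Lemma ger_mul_rate b b' y : 0 < b -> b <= b' ->
  b' * rate (-1) b' y <= b * rate (-1) b y.
Proof.
move=> b0 bb'; have b'0 := lt_le_trans b0 bb'.
rewrite !mul_rate// ler_pM2r ?invr_gt0// lerD2l ler_wsqrtr// !mulN1r lerD2l lerN2 ler_pM2l//.
by rewrite ler_pXn2r// nnegrE ltW.
Qed.

Lemma sqrB_ge0 b y : 0 < b -> 2 * b <= y -> 0 <= y ^+ 2 + -1 * (4 * b ^+ 2).
Proof.
move=> b0 by'.
have -> : y ^+ 2 + -1 * (4 * b ^+ 2) = (y - 2 * b) * (y + 2 * b) by ring.
by apply: mulr_ge0; lra.
Qed.

Lemma sqrD_ge0 b y : 0 <= y ^+ 2 + 1 * (4 * b ^+ 2).
Proof. by rewrite mul1r addr_ge0 ?sqr_ge0// mulr_ge0 ?sqr_ge0. Qed.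

Lemma sqrtrB_le (u v : R) : 0 <= u -> u <= v -> Num.sqrt v - Num.sqrt u <= Num.sqrt (v - u).
Proof.
move=> u0 uv; rewrite lerBlDr.
have v0 := le_trans u0 uv.
rewrite -[X in _ <= X]ger0_norm ?addr_ge0 ?sqrtr_ge0// -sqrtr_sqr ler_wsqrtr//.
rewrite sqrrD !sqr_sqrtr ?subr_ge0//.
have : 0 <= Num.sqrt (v - u) * Num.sqrt u by rewrite mulr_ge0 ?sqrtr_ge0.
lra.
Qed.

(** Subadditivity of the square root bounds the drop by sqrt (b'^2 - b^2). This stays uniform up to
    the turning point y = 2 b', where the derivative of the square root blows up. *)
Lemma mul_rateN1_decrement b b' y e : 0 < b -> b <= b' -> 2 * b' <= y ->
  0 <= e -> b' ^+ 2 - b ^+ 2 <= e ^+ 2 ->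
  b * rate (-1) b y - e <= b' * rate (-1) b' y.
Proof.
move=> b0 bb' hy e0 he; have b'0 := lt_le_trans b0 bb'.
rewrite !mul_rate//.
have h1 := sqrB_ge0 b'0 hy.
have h2 : y ^+ 2 + -1 * (4 * b' ^+ 2) <= y ^+ 2 + -1 * (4 * b ^+ 2).
  rewrite !mulN1r lerD2l lerN2 ler_pM2l//.
  by rewrite ler_pXn2r// nnegrE ltW.
have := sqrtrB_le h1 h2.
set q := Num.sqrt (_ - _).
suff : q <= 2 * e by lra.
rewrite -[X in _ <= X]ger0_norm ?mulr_ge0// -sqrtr_sqr ler_wsqrtr// exprMn.
lra.
Qed.

(** Starts the induction of [orthopoly_le_prod], where P_1 / P_0 = x / b_0 has to lie below the
    first fixpoint. *)
Lemma mul_rateN1_ge b y e : 0 < b -> 2 * b <= y -> b <= e ->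
  y - e <= b * rate (-1) b y.
Proof.
move=> b0 hy be; rewrite mul_rate//.
set q := Num.sqrt _.
suff : y - 2 * b <= q by lra.
rewrite -[X in X <= _]ger0_norm; last by lra.
rewrite -sqrtr_sqr ler_wsqrtr//.
have : 0 <= b * (y - 2 * b) by apply: mulr_ge0; lra.
rewrite !expr2; lra.
Qed.

End Rate.

(** * The polynomials with coefficients in absolute value *)

Section AbsPoly.
Variable R : realFieldType.
Variable b : nat -> R.
Hypothesis b_gt0 : forall n, 0 < b n.

(* i^(-n) P_n(i x): the coefficients are those of P_n in absolute value. *)
Fixpoint abs_orthopoly (n : nat) : {poly R} :=
  if n is k.+1 then
    (b k)^-1 *: ('X * abs_orthopoly k
                 + (if k is m.+1 then b m *: abs_orthopoly m else 0))
  else 1.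

Lemma orthopolySS n : orthopoly b n.+2 =
  (b n.+1)^-1 *: ('X * orthopoly b n.+1 - b n *: orthopoly b n).
Proof. by []. Qed.

Lemma abs_orthopolySS n : abs_orthopoly n.+2 =
  (b n.+1)^-1 *: ('X * abs_orthopoly n.+1 + b n *: abs_orthopoly n).
Proof. by []. Qed.

Lemma horner_orthopoly0 x : (orthopoly b 0).[x] = 1.
Proof. by rewrite hornerE. Qed.

Lemma horner_orthopoly1 x : b 0 * (orthopoly b 1).[x] = x.
Proof. by rewrite /= subr0 mulr1 hornerZ hornerX mulrA divff ?mul1r// gt_eqF. Qed.

Lemma horner_orthopolySS x n : b n.+1 * (orthopoly b n.+2).[x] =
  x * (orthopoly b n.+1).[x] - b n * (orthopoly b n).[x].
Proof.
rewrite orthopolySS hornerZ hornerD hornerN hornerM hornerX (hornerZ (b n)).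
by rewrite mulrA divff ?mul1r// gt_eqF. Qed.

Lemma horner_abs_orthopoly0 x : (abs_orthopoly 0).[x] = 1.
Proof. by rewrite hornerE. Qed.

Lemma horner_abs_orthopoly1 x : b 0 * (abs_orthopoly 1).[x] = x.
Proof. by rewrite /= addr0 mulr1 hornerZ hornerX mulrA divff ?mul1r// gt_eqF. Qed.

Lemma horner_abs_orthopolySS x n : b n.+1 * (abs_orthopoly n.+2).[x] =
  x * (abs_orthopoly n.+1).[x] + b n * (abs_orthopoly n).[x].
Proof.
rewrite abs_orthopolySS hornerZ hornerD hornerM hornerX (hornerZ (b n)).
by rewrite mulrA divff ?mul1r// gt_eqF. Qed.

Lemma nat_ind2 (P : nat -> Prop) : P 0%N -> P 1%N ->
  (forall n, P n -> P n.+1 -> P n.+2) -> forall n, P n.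
Proof.
move=> P0 P1 PS n; suff : P n /\ P n.+1 by case.
by elim: n => [|n [Pn Pn1]]; split => //; apply: PS.
Qed.

Lemma coef_abs_orthopoly_ge0 n k : 0 <= (abs_orthopoly n)`_k.
Proof.
elim/nat_ind2: n k => [k||n IH0 IH1 k].
- by rewrite coefC; case: ifP.
- by move=> k /=; rewrite addr0 mulr1 coefZ coefX mulr_ge0 ?ler0n// invr_ge0 ltW.
- rewrite abs_orthopolySS coefZ mulr_ge0//; first by rewrite invr_ge0 ltW.
  rewrite coefD coefXM (coefZ (b n)) addr_ge0//; first by case: ifP.
  by rewrite mulr_ge0// ltW.
Qed.

(** For n + k even the exponent has the parity of (n - k)/2, the sign produced by i^(n - k); the
    form with sums avoids truncated subtraction. For n + k odd both coefficients vanish. *)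
Lemma coef_orthopoly n k :
  (orthopoly b n)`_k = (-1) ^+ ((n + k)./2 + k) * (abs_orthopoly n)`_k.
Proof.
elim/nat_ind2: n k => [k||n IH0 IH1 k].
- rewrite !coefC; case: eqP => [->|_]; last by rewrite mulr0.
  by rewrite mul1r.
- move=> k /=; rewrite subr0 addr0 mulr1 !coefZ coefX.
  case: eqP => [->|_]; last by rewrite !mulr0.
  by rewrite -[(uphalf _ + 1)%N]/2%N sqrrN expr1n mul1r.
- rewrite orthopolySS abs_orthopolySS 2!coefZ coefB coefD 2!coefXM 2!(coefZ (b n)) IH0.
  case: k => [|k].
    rewrite !addn0 /= exprS; ring.
  have -> : (n.+2 + k.+1)./2 = ((n + k.+1)./2).+1 by rewrite !addSn.
  rewrite (negbTE (isT : k.+1 != 0%N)) [k.+1.-1]/= IH1 addSnnS.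
  rewrite addnS addSn addnS !exprS; ring.
Qed.

Lemma sqr_coef_orthopoly n k : ((orthopoly b n)`_k) ^+ 2 = ((abs_orthopoly n)`_k) ^+ 2.
Proof. by rewrite coef_orthopoly exprMn sqrr_sign mul1r. Qed.

Lemma coef_abs_orthopoly_odd n k : odd (n + k) -> (abs_orthopoly n)`_k = 0.
Proof.
elim/nat_ind2: n k => [k||n IH0 IH1 k].
- by rewrite coefC; case: k.
- move=> k /=; rewrite addr0 mulr1 !coefZ coefX.
  by case: eqP => [->|_]; rewrite ?mulr0.
- rewrite abs_orthopolySS /= negbK => nk.
  rewrite coefZ coefD coefXM (coefZ (b n)) IH0// mulr0 addr0.
  case: k nk => [|k] nk /=; first by rewrite mulr0.
  rewrite IH1 ?mulr0//.
  by move: nk; rewrite addnS addSn.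
Qed.

Lemma horner_orthopolyN n x : (orthopoly b n).[- x] = (-1) ^+ n * (orthopoly b n).[x].
Proof.
elim/nat_ind2: n => [||n IH0 IH1].
- by rewrite !hornerE.
- apply: (mulfI (lt0r_neq0 (b_gt0 0))).
  by rewrite mulrCA !horner_orthopoly1// expr1 mulN1r.
- apply: (mulfI (lt0r_neq0 (b_gt0 n.+1))).
  rewrite mulrCA !horner_orthopolySS IH0 IH1 !exprS; ring.
Qed.

Lemma horner_abs_orthopoly_ge0 n y : 0 <= y -> 0 <= (abs_orthopoly n).[y].
Proof.
move=> y0; rewrite horner_coef sumr_ge0// => i _.
by rewrite mulr_ge0 ?exprn_ge0// coef_abs_orthopoly_ge0.
Qed.

Lemma ler_horner_abs_orthopoly n y y' : 0 <= y -> y <= y' ->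
  (abs_orthopoly n).[y] <= (abs_orthopoly n).[y'].
Proof.
move=> y0 yy'; rewrite !horner_coef ler_sum// => i _.
by rewrite ler_wpM2l ?coef_abs_orthopoly_ge0// lerXn2r// nnegrE (le_trans y0).
Qed.

Lemma coef_le_horner_abs_orthopoly n k y : 0 <= y ->
  (abs_orthopoly n)`_k * y ^+ k <= (abs_orthopoly n).[y].
Proof.
move=> y0; have [kn|nk] := ltnP k (size (abs_orthopoly n)); last first.
  by rewrite nth_default// mul0r horner_abs_orthopoly_ge0.
rewrite horner_coef (bigD1 (Ordinal kn))//= lerDl sumr_ge0// => i _.
by rewrite mulr_ge0 ?exprn_ge0// coef_abs_orthopoly_ge0.
Qed.

Lemma size_abs_orthopoly n : (size (abs_orthopoly n) <= n.+1)%N.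
Proof.
elim/nat_ind2: n => [||n IH0 IH1].
- by rewrite size_poly1.
- by rewrite /= addr0 mulr1 (leq_trans (size_scale_leq _ _))// size_polyX.
- rewrite abs_orthopolySS (leq_trans (size_scale_leq _ _))//.
  rewrite (leq_trans (size_polyD _ _))// geq_max; apply/andP; split.
    rewrite (leq_trans (size_polyMleq _ _))// size_polyX /=.
    by rewrite ltnS.
  by rewrite (leq_trans (size_scale_leq _ _))// (leq_trans IH0)// ltnS ltnW.
Qed.

Lemma horner_abs_orthopoly_even n y : (abs_orthopoly n.*2).[y] =
  \sum_(k < n.+1) (abs_orthopoly n.*2)`_k.*2 * y ^+ k.*2.
Proof.
have odd0 (f : nat -> R) (m : nat) : (forall k, f k.*2.+1 = 0) ->
    \sum_(k < m.*2.+1) f k = \sum_(k < m.+1) f k.*2.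
  move=> f0; elim: m => [|m IH]; first by rewrite !big_ord_recr !big_ord0.
  by rewrite doubleS 2!big_ord_recr IH [RHS]big_ord_recr /= f0 addr0 doubleS.
rewrite (@horner_coef_wide _ n.*2.+1) ?size_abs_orthopoly//.
rewrite (odd0 (fun k => (abs_orthopoly n.*2)`_k * y ^+ k))// => k.
by rewrite coef_abs_orthopoly_odd ?mul0r// addnS -doubleD /= odd_double.
Qed.

Lemma norm_orthopoly_le n x : `|(orthopoly b n).[x]| <= (abs_orthopoly n).[`|x|].
Proof.
elim/nat_ind2: n => [||n IH0 IH1].
- by rewrite !hornerE normr1.
- rewrite -(ler_pM2l (b_gt0 0)) horner_abs_orthopoly1.
  by rewrite -[X in X * _]gtr0_norm// -normrM horner_orthopoly1.
- rewrite -(ler_pM2l (b_gt0 n.+1)) horner_abs_orthopolySS.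
  rewrite -[X in X * _]gtr0_norm// -normrM horner_orthopolySS.
  rewrite (le_trans (ler_normB _ _))// !normrM (gtr0_norm (b_gt0 n)).
  by rewrite lerD// ler_wpM2l// ltW.
Qed.

End AbsPoly.

(** * Comparison of solutions with products of fixpoints *)

Section Growth.
Variable R : rcfType.
Variable b : nat -> R.
Implicit Types (s d x y : R) (m n k : nat).
Hypothesis b_gt0 : forall n, 0 < b n.
Hypothesis b_le : forall n, b n <= b n.+1.

Lemma b_homo m n : (m <= n)%N -> b m <= b n.
Proof. exact: (homo_leq (@lexx _ R) (@le_trans _ R) b_le). Qed.

Lemma prod_rate_gt0 s y n : 0 < y -> 0 < \prod_(j < n) rate s (b j) y.
Proof. by move=> y0; apply: prodr_gt0 => i _; exact: rate_gt0. Qed.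

(** Let r_n be [rate 1 (b n) y]. By the fixpoint equation b_n / r_n = b_n r_n - y, which is
    nondecreasing in n; hence the product is a supersolution of the recursion. *)
Lemma abs_orthopoly_le_prod y n : 0 < y ->
  (abs_orthopoly b n).[y] <= \prod_(j < n) rate 1 (b j) y.
Proof.
move=> y0; have r0 k : 0 < rate 1 (b k) y by exact: rate_gt0.
have fp k : b k * rate 1 (b k) y = y + b k / rate 1 (b k) y.
  by rewrite [LHS]rate_fixpoint ?sqrD_ge0// mul1r.
elim/nat_ind2: n => [||n IH0 IH1].
- by rewrite horner_abs_orthopoly0 big_ord0.
- rewrite big_ord1 -(ler_pM2l (b_gt0 0)) horner_abs_orthopoly1// fp lerDl.
  by rewrite divr_ge0// ltW.
- rewrite -(ler_pM2l (b_gt0 n.+1)) horner_abs_orthopolySS// big_ord_recr /=.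
  rewrite mulrCA fp mulrDr mulrC lerD//; first by rewrite ler_pM2r.
  rewrite (le_trans (ler_wpM2l (ltW (b_gt0 n)) IH0))// big_ord_recr /=.
  have h : b n / rate 1 (b n) y <= b n.+1 / rate 1 (b n.+1) y.
    by rewrite -(lerD2l y) -!fp ler_mul_rate.
  rewrite mulrC -mulrA ler_pM2l ?prod_rate_gt0// mulrC.
  by rewrite -ler_pdivrMr.
Qed.

(** The last rate r_n is replaced by the smaller y / b_n = r_n - 1/r_n. With this loss the two-step
    induction reduces to b_n r_n <= b_(n+1) r_(n+1). *)
Lemma abs_orthopoly_ge_prod y n : 0 < y ->
  y / b n * \prod_(j < n) rate 1 (b j) y <= (abs_orthopoly b n.+1).[y].
Proof.
move=> y0; have r0 k : 0 < rate 1 (b k) y by exact: rate_gt0.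
have fp k : b k * rate 1 (b k) y = y + b k / rate 1 (b k) y.
  by rewrite [LHS]rate_fixpoint ?sqrD_ge0// mul1r.
have bn0 k : b k != 0 by rewrite gt_eqF.
have rn0 k : rate 1 (b k) y != 0 by rewrite gt_eqF.
elim/nat_ind2: n => [||n IH0 IH1].
- by rewrite big_ord0 mulr1 ler_pdivrMr// mulrC horner_abs_orthopoly1.
- rewrite big_ord1 -(ler_pM2l (b_gt0 1)) horner_abs_orthopolySS//.
  rewrite horner_abs_orthopoly0 mulr1 mulrA [b 1 * _]mulrC divfK//.
  have -> : (abs_orthopoly b 1).[y] = y / b 0.
    by apply: (mulfI (bn0 0)); rewrite horner_abs_orthopoly1// mulrCA divff// mulr1.
  have -> : rate 1 (b 0) y = y / b 0 + (rate 1 (b 0) y)^-1.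
    by apply: (mulfI (bn0 0)); rewrite fp; field; rewrite bn0 rn0.
  by rewrite mulrDr lerD2l ler_pdivrMr// fp lerDl divr_ge0// ltW.
- rewrite -(ler_pM2l (b_gt0 n.+2)) horner_abs_orthopolySS//.
  set P := \prod_(j < n.+2) _.
  rewrite mulrA [b n.+2 * _]mulrC divfK// /P big_ord_recr /=.
  set Q := \prod_(j < n.+1) _ in IH1 *.
  have Q0 : 0 < Q by exact: prod_rate_gt0.
  apply: (@le_trans _ _ (y * (y / b n.+1 * Q) + y * Q / rate 1 (b n.+1) y)).
    rewrite le_eqVlt; apply/orP; left; apply/eqP.
    have e : rate 1 (b n.+1) y = y / b n.+1 + (rate 1 (b n.+1) y)^-1.
      by apply: (mulfI (bn0 n.+1)); rewrite fp; field; rewrite bn0 rn0.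
    by rewrite {1}e; ring.
  rewrite lerD ?ler_pM2l//.
  rewrite (le_trans _ (ler_wpM2l (ltW (b_gt0 n.+1)) IH0))//.
  rewrite /Q big_ord_recr /= ler_pdivrMr//.
  set Z := \prod_(j < n) _; have Z0 : 0 < Z by exact: prod_rate_gt0.
  have h := ler_mul_rate y (b_gt0 n) (b_le n).
  have -> : b n.+1 * (y / b n * Z) * rate 1 (b n.+1) y =
      (y * Z / b n) * (b n.+1 * rate 1 (b n.+1) y) by ring.
  rewrite (le_trans _ (ler_wpM2l _ h))//.
    by rewrite [_ / b n * _]mulrA divfK// mulrA.
  by rewrite ltW// divr_gt0// mulr_gt0.
Qed.

(** The ratios rho_n = P_(n+1)(x) / P_n(x) satisfy b_(n+1) rho_(n+1) = x - b_n / rho_n, which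
    increases with rho_n, while b_n times the fixpoint decreases with n. So rho_n stays above the
    fixpoint and is positive. *)
Lemma orthopoly_ge_prod x n : (forall j, (j < n)%N -> 2 * b j <= x) ->
  \prod_(j < n) rate (-1) (b j) x <= (orthopoly b n).[x].
Proof.
have x_gt0 m : (forall j, (j < m.+1)%N -> 2 * b j <= x) -> 0 < x.
  by move=> /(_ 0%N isT); apply: lt_le_trans; rewrite mulr_gt0.
have fp k : 0 < x -> 2 * b k <= x ->
    b k * rate (-1) (b k) x = x - b k / rate (-1) (b k) x.
  by move=> x0 h; rewrite [LHS]rate_fixpoint ?sqrB_ge0// !mulN1r mulNr.
suff H m : (forall j, (j < m.+1)%N -> 2 * b j <= x) ->
    0 < (orthopoly b m).[x] /\
    rate (-1) (b m) x * (orthopoly b m).[x] <= (orthopoly b m.+1).[x].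
  elim: n => [_|n IH hn]; first by rewrite big_ord0 horner_orthopoly0.
  have [_ h] := H _ hn; rewrite big_ord_recr /= mulrC (le_trans _ h)//.
  apply: ler_wpM2l; first by rewrite ltW// rate_gt0// (x_gt0 n).
  by apply: IH => j jn; apply: hn; rewrite ltnS ltnW.
elim: m => [h|m IH h]; have x0 := x_gt0 _ h.
  rewrite horner_orthopoly0; split => //; rewrite mulr1.
  rewrite -(ler_pM2l (b_gt0 0)) horner_orthopoly1// fp ?h// gerBl.
  by rewrite divr_ge0 ?ltW ?rate_gt0.
have h' j : (j < m.+1)%N -> 2 * b j <= x.
  by move=> jm; apply: h; rewrite ltnS ltnW.
have [P0 P1] := IH h'.
have r0 k : 0 < rate (-1) (b k) x by exact: rate_gt0.
have P1_gt0 : 0 < (orthopoly b m.+1).[x] by rewrite (lt_le_trans _ P1)// mulr_gt0.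
split => //; rewrite -(ler_pM2l (b_gt0 m.+1)) horner_orthopolySS// mulrA.
rewrite (le_trans (ler_wpM2r (ltW P1_gt0) (ger_mul_rate x (b_gt0 m) (b_le m))))//.
rewrite fp ?h'// mulrBl lerD2l lerN2 mulrAC ler_pdivlMr//.
by rewrite -mulrA ler_pM2l// mulrC.
Qed.

(* The hypotheses on d make the fixpoints at x + d a supersolution of the recursion
   satisfied by the ratios P_(n+1)(x) / P_n(x). *)
Lemma orthopoly_le_prod x d n : 0 <= d -> b 0 <= d ->
  (forall j, 2 * b j <= x -> (b j.+1) ^+ 2 - (b j) ^+ 2 <= d ^+ 2) ->
  (forall j, (j < n)%N -> 2 * b j <= x) ->
  0 <= (orthopoly b n).[x] <= \prod_(j < n) rate (-1) (b j) (x + d).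
Proof.
move=> d0 b0d hd.
have x_gt0 m : (forall j, (j < m.+1)%N -> 2 * b j <= x) -> 0 < x.
  by move=> /(_ 0%N isT); apply: lt_le_trans; rewrite mulr_gt0.
have fp k : 0 < x -> 2 * b k <= x ->
    b k * rate (-1) (b k) (x + d) = (x + d) - b k / rate (-1) (b k) (x + d).
  move=> x0 h; rewrite [LHS]rate_fixpoint ?sqrB_ge0// ?mulN1r ?mulNr ?ltr_wpDr//.
  by rewrite (le_trans h)// lerDl.
suff H m : (forall j, (j < m.+1)%N -> 2 * b j <= x) ->
    0 < (orthopoly b m).[x] /\
    (orthopoly b m.+1).[x] <= rate (-1) (b m) (x + d) * (orthopoly b m).[x].
  elim: n => [_|n IH hn]; first by rewrite big_ord0 horner_orthopoly0 ler01 lexx.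
  have x0 := x_gt0 n hn.
  apply/andP; split.
    by rewrite (le_trans _ (orthopoly_ge_prod hn))// ltW// prod_rate_gt0.
  have [_ h] := H _ hn; rewrite (le_trans h)// big_ord_recr /= mulrC.
  apply: ler_wpM2r; first by rewrite ltW// rate_gt0// ltr_wpDr.
  suff /IH/andP[] : forall j, (j < n)%N -> 2 * b j <= x by [].
  by move=> j jn; apply: hn; rewrite ltnS ltnW.
elim: m => [h|m IH h]; have x0 := x_gt0 _ h.
  rewrite horner_orthopoly0; split => //; rewrite mulr1.
  rewrite -(ler_pM2l (b_gt0 0)) horner_orthopoly1//.
  rewrite (le_trans _ (mul_rateN1_ge (b_gt0 0) _ b0d)) ?addrK//.
  by rewrite (le_trans (h 0%N isT))// lerDl.
have h' j : (j < m.+1)%N -> 2 * b j <= x.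
  by move=> jm; apply: h; rewrite ltnS ltnW.
have [P0 P1] := IH h'.
have r0 k : 0 < rate (-1) (b k) (x + d) by rewrite rate_gt0// ltr_wpDr.
have P1_gt0 : 0 < (orthopoly b m.+1).[x].
  by rewrite (lt_le_trans _ (orthopoly_ge_prod h'))// prod_rate_gt0.
split => //; rewrite -(ler_pM2l (b_gt0 m.+1)) horner_orthopolySS// mulrA.
have hx : 2 * b m.+1 <= x + d by rewrite (le_trans (h m.+1 _))// lerDl.
have := mul_rateN1_decrement (b_gt0 m) (b_le m) hx d0 (hd m (h' m _)).
move=> /(_ (ltnSn m)) /(ler_wpM2r (ltW P1_gt0)); apply: le_trans.
rewrite fp ?h'// addrAC addrK mulrBl lerD2l lerN2 mulrAC ler_pdivrMr//.
by rewrite -mulrA ler_pM2l// mulrC.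
Qed.

(** Since x / b_(n+1) <= 2 and b_n / b_(n+1) <= 1 from there on, one step at most triples the
    maximum. This bridges the zone just beyond the turning point, before the energy bound becomes
    effective. *)
Lemma orthopoly_crude x m k : 0 <= x -> x <= 2 * b m.+1 ->
  Num.max `|(orthopoly b (m + k)).[x]| `|(orthopoly b (m + k).+1).[x]| <=
  3 ^+ k * Num.max `|(orthopoly b m).[x]| `|(orthopoly b m.+1).[x]|.
Proof.
move=> x0 hx; elim: k => [|k IH]; first by rewrite addn0 mul1r.
rewrite addnS exprS -mulrA (le_trans _ (ler_wpM2l _ IH))//.
set u := `|(orthopoly b (m + k)).[x]|; set v := `|(orthopoly b (m + k).+1).[x]|.
have v0 : 0 <= v by exact: normr_ge0.
have u0 : 0 <= u by exact: normr_ge0.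
have uM : u <= Num.max u v by rewrite le_max lexx.
have vM : v <= Num.max u v by rewrite le_max lexx orbT.
move: (Num.max u v) uM vM => M uM vM.
rewrite ge_max; apply/andP; split; first by lra.
have [bk bk1] := (b_gt0 (m + k), b_gt0 (m + k).+1).
rewrite -(ler_pM2l bk1) -[X in X * `|_|]gtr0_norm// -normrM horner_orthopolySS//.
rewrite (le_trans (ler_normB _ _))// !normrM (gtr0_norm bk) (ger0_norm x0) -/u -/v.
have h1 : x <= 2 * b (m + k).+1.
  by rewrite (le_trans hx)// ler_pM2l// b_homo// ltnS leq_addr.
have h2 := b_le (m + k).
have h3 : x * v <= 2 * b (m + k).+1 * M by rewrite ler_pM.
have h4 : b (m + k) * u <= b (m + k).+1 * M by rewrite ler_pM// ltW.
by rewrite mulrCA; lra.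
Qed.

(** For constant b the recursion conserves this quadratic form; for x >= 0 it is positive definite
    exactly when x < 2 b_n, the oscillatory range. *)
Definition energy x n := b n ^+ 2 * ((orthopoly b n.+1).[x] ^+ 2 + (orthopoly b n).[x] ^+ 2)
  - x * b n * (orthopoly b n.+1).[x] * (orthopoly b n).[x].

Lemma energyS x n : energy x n.+1 =
  energy x n + (b n.+1 ^+ 2 - b n ^+ 2) * (orthopoly b n.+1).[x] ^+ 2.
Proof.
rewrite /energy.
have h := horner_orthopolySS b_gt0 x n.
move: (orthopoly b n.+2).[x] (orthopoly b n.+1).[x] (orthopoly b n).[x] h => p2 p1 p0 h.
transitivity ((b n.+1 * p2) ^+ 2 + b n.+1 ^+ 2 * p1 ^+ 2 - x * (b n.+1 * p2) * p1).
  by ring.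
by rewrite h; ring.
Qed.

Lemma energy_ge x n :
  (b n ^+ 2 - x ^+ 2 / 4) * (orthopoly b n).[x] ^+ 2 <= energy x n.
Proof.
rewrite -subr_ge0.
have -> : energy x n - (b n ^+ 2 - x ^+ 2 / 4) * (orthopoly b n).[x] ^+ 2 =
  (b n * (orthopoly b n.+1).[x] - x / 2 * (orthopoly b n).[x]) ^+ 2.
  by rewrite /energy; field.
exact: sqr_ge0.
Qed.

(* energy / (b_n^2 - x^2/4) is nonincreasing for n >= m. *)
Lemma orthopoly_oscillatory x m n : 0 <= x -> x < 2 * b m -> (m <= n)%N ->
  (b m ^+ 2 - x ^+ 2 / 4) * (orthopoly b n).[x] ^+ 2 <= energy x m.
Proof.
move=> x0 hm mn.
have pos k : (m <= k)%N -> 0 < b k ^+ 2 - x ^+ 2 / 4.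
  move=> mk; have := b_homo mk => bmk.
  have : x ^+ 2 < (2 * b k) ^+ 2.
    rewrite ltr_pXn2r// ?nnegrE//; first by lra.
    by rewrite mulr_ge0// ltW.
  by rewrite exprMn; lra.
have H : energy x n * (b m ^+ 2 - x ^+ 2 / 4) <= energy x m * (b n ^+ 2 - x ^+ 2 / 4).
  elim: n mn => [|n IH]; first by rewrite leqn0 => /eqP ->.
  rewrite leq_eqVlt => /predU1P[-> //|]; rewrite ltnS => mn.
  have {}IH := IH mn.
  have p0 := pos _ mn; have p1 := pos _ (leqW mn); have pm := pos _ (leqnn m).
  rewrite -(ler_pM2r p0) -mulrA [_ * (b n ^+ 2 - _)]mulrC mulrA.
  have h : energy x n.+1 * (b n ^+ 2 - x ^+ 2 / 4) <=
           energy x n * (b n.+1 ^+ 2 - x ^+ 2 / 4).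
    have := energy_ge x n.+1; rewrite energyS.
    set E := energy x n; set P := (orthopoly b n.+1).[x] ^+ 2.
    have : 0 <= b n.+1 ^+ 2 - b n ^+ 2.
      by rewrite subr_ge0 ler_pXn2r// nnegrE ltW.
    move: (b n.+1 ^+ 2) (b n ^+ 2) (x ^+ 2 / 4) => B1 B0 X B10 hE.
    rewrite -subr_ge0; have -> : E * (B1 - X) - (E + (B1 - B0) * P) * (B0 - X) =
      (B1 - B0) * (E + (B1 - B0) * P - (B1 - X) * P) by ring.
    by rewrite mulr_ge0// subr_ge0.
  rewrite (le_trans (ler_wpM2r (ltW pm) h))// -!mulrA.
  rewrite [X in _ * X <= _]mulrC [X in _ <= _ * X]mulrC !mulrA ler_pM2r//.
have := energy_ge x n; rewrite -(ler_pM2l (pos _ (leqnn m))) mulrCA => h.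
rewrite -(ler_pM2l (pos _ mn)) (le_trans h)// [X in X <= _]mulrC.
by rewrite (le_trans H)// mulrC.
Qed.


Lemma rate_ge1 y k : 0 < y -> 1 <= rate 1 (b k) y.
Proof.
move=> y0; rewrite /rate ler_pdivlMr ?mulr_gt0// !mul1r.
suff h : 2 * b k <= Num.sqrt (y ^+ 2 + 4 * b k ^+ 2).
  by rewrite (le_trans h)// lerDr ltW.
rewrite -[X in X <= _]ger0_norm; last by rewrite mulr_ge0// ltW.
rewrite -sqrtr_sqr ler_wsqrtr//.
by have := sqr_ge0 y; lra.
Qed.

(** The fixpoint equation reads r^2 = 1 + (y / b_k) r, and r >= 1. It turns the growth factor 1 + y
    / b_k of the tail estimate into a power of the rate, and products of rates are under control. *)
Lemma rate_sqr_ge y k : 0 < y -> 1 + y / b k <= rate 1 (b k) y ^+ 2.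
Proof.
move=> y0; have r1 := rate_ge1 k y0; have r0 := rate_gt0 1 (b_gt0 k) y0.
have := rate_fixpoint (b_gt0 k) y0 (sqrD_ge0 (b k) y); set r := rate _ _ _ in r0 r1 * => h.
have -> : r ^+ 2 = 1 + y / b k * r.
  apply: (mulfI (lt0r_neq0 (b_gt0 k))).
  rewrite mulrDr mulr1 [X in _ = _ + X]mulrA [b k * (y / _)]mulrC divfK ?gt_eqF//.
  by rewrite expr2 mulrA h mulrDl divfK ?gt_eqF// mul1r addrC.
by rewrite lerD2l ler_peMr// divr_ge0// ltW.
Qed.

(** * Decay of the tail for log-concave coefficients *)

Section LogConcave.
Hypothesis b_logconcave : forall n, b n.+2 * b n <= b n.+1 ^+ 2.

Lemma ratio_le n : b n.+1 / b n <= b 1 / b 0.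
Proof.
elim: n => [//|n IH]; apply: le_trans IH.
rewrite ler_pdivrMr// mulrAC ler_pdivlMr//; exact: b_logconcave.
Qed.

(** A uniform bound M does not make the squares summable. But solutions of the recursion at y = 0
    are O(b_n^(-1/2)), and for y > 0 this survives at the cost of factors 1 + y / b_j. The bound M
    serves only to start at n0. *)
Lemma abs_orthopoly_tail y M n0 n : 0 < y ->
  (forall k, (abs_orthopoly b k).[y] <= M) -> (n0 < n)%N ->
  b n * (abs_orthopoly b n).[y] ^+ 2 <=
  b 1 / b 0 * b n0.+1 * M ^+ 2 * \prod_(n0.+1 <= j < n) rate 1 (b j) y ^+ 4.
Proof.
move=> y0 hM; case: n => [//|n]; rewrite ltnS => n0n.
have q0 k : 0 <= (abs_orthopoly b k).[y] by rewrite horner_abs_orthopoly_ge0// ltW.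
have s0 k : 0 < Num.sqrt (b k) by rewrite sqrtr_gt0.
have ss k : Num.sqrt (b k) * Num.sqrt (b k) = b k by rewrite -expr2 sqr_sqrtr// ltW.
have sle k : Num.sqrt (b k) <= Num.sqrt (b k.+1) by rewrite ler_wsqrtr.
(* With these weights a step at y = 0 exchanges the two entries without increasing them: the new
   first entry is the old second one, and the new second is at most the old first by log-concavity.
   For y > 0 the additional term costs the factor 1 + y / b_(k+1). *)
pose Z k := Num.max (b k.+1 / Num.sqrt (b k) * (abs_orthopoly b k.+2).[y])
                    (Num.sqrt (b k.+1) * (abs_orthopoly b k.+1).[y]).
have Z0 k : 0 <= Z k by rewrite /Z le_max [X in _ || X]mulr_ge0 ?orbT// ltW.
have ZS k : Z k.+1 <= (1 + y / b k.+1) * Z k.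
  have h1 : b k.+1 / Num.sqrt (b k) * (abs_orthopoly b k.+2).[y] <= Z k.
    by rewrite /Z le_max lexx.
  have h2 : Num.sqrt (b k.+1) * (abs_orthopoly b k.+1).[y] <= Z k.
    by rewrite /Z le_max lexx orbT.
  have h3 : b k.+1 * (abs_orthopoly b k.+2).[y] <= Num.sqrt (b k) * Z k.
    by move: h1; rewrite mulrAC ler_pdivrMr// [Z k * _]mulrC.
  rewrite {1}/Z ge_max; apply/andP; split.
    rewrite mulrAC ler_pdivrMr// horner_abs_orthopolySS//.
    rewrite mulrDl mul1r mulrDl [X in _ <= X]addrC; apply: lerD.
      have h4 : (abs_orthopoly b k.+2).[y] <= Num.sqrt (b k.+1) * Z k / b k.+1.
        by rewrite ler_pdivlMr// mulrC (le_trans h3)// ler_wpM2r.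
      have -> : y / b k.+1 * Z k * Num.sqrt (b k.+1) =
          y * (Num.sqrt (b k.+1) * Z k / b k.+1) by ring.
      by rewrite ler_pM2l.
    by rewrite -[X in X * _ <= _]ss -mulrA mulrC ler_pM2r.
  rewrite (@le_trans _ _ (Z k))//; last first.
    by rewrite mulrDl mul1r lerDl mulr_ge0// divr_ge0// ltW.
  rewrite -(ler_pM2l (b_gt0 k.+1)) mulrCA.
  rewrite (le_trans (ler_wpM2l (ltW (s0 _)) h3))// mulrA ler_wpM2r//.
  rewrite -[X in _ <= X]ger0_norm ?(ltW (b_gt0 _))// -sqrtr_sqr -sqrtrM ?(ltW (b_gt0 _))//.
  by rewrite ler_wsqrtr.
have Zn k : (n0 <= k)%N ->
    Z k <= Z n0 * \prod_(n0.+1 <= j < k.+1) rate 1 (b j) y ^+ 2.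
  elim: k => [|k IH].
    by rewrite leqn0 => /eqP ->; rewrite big_geq// mulr1.
  rewrite leq_eqVlt => /predU1P[<-|]; first by rewrite big_geq// mulr1.
  rewrite ltnS => n0k; rewrite big_nat_recr//= (le_trans (ZS k))// mulrA mulrC.
  by apply: ler_pM => //; [rewrite addr_ge0// divr_ge0// ltW|exact: IH|exact: rate_sqr_ge].
have Zn0 : Z n0 ^+ 2 <= b 1 / b 0 * b n0.+1 * M ^+ 2.
  have M0 : 0 <= M by rewrite (le_trans (q0 0%N)).
  have : Z n0 <= b n0.+1 / Num.sqrt (b n0) * M.
    rewrite /Z ge_max; apply/andP; split.
      by rewrite ler_wpM2l// divr_ge0 ?sqrtr_ge0// ltW.
    apply: ler_pM => //.
    by rewrite ler_pdivlMr// -[X in _ <= X]ss ler_pM2l.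
  move=> h; apply: (@le_trans _ _ ((b n0.+1 / Num.sqrt (b n0) * M) ^+ 2)).
    by rewrite ler_pXn2r// nnegrE// mulr_ge0// divr_ge0 ?sqrtr_ge0// ltW.
  rewrite exprMn ler_wpM2r ?sqr_ge0// expr_div_n sqr_sqrtr ?(ltW (b_gt0 _))//.
  rewrite expr2 mulrAC ler_wpM2r ?(ltW (b_gt0 _))//; exact: ratio_le.
have -> : \prod_(n0.+1 <= j < n.+1) rate 1 (b j) y ^+ 4 =
    (\prod_(n0.+1 <= j < n.+1) rate 1 (b j) y ^+ 2) ^+ 2.
  by rewrite -prodrXl; apply: eq_bigr => j _; rewrite -exprM.
rewrite -[X in X * _ <= _]ss -expr2 -exprMn (@le_trans _ _ (Z n ^+ 2))//.
  rewrite ler_pXn2r// ?nnegrE//; last by rewrite mulr_ge0// ltW.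
  by rewrite /Z le_max lexx orbT.
apply: (@le_trans _ _ ((Z n0 * \prod_(n0.+1 <= j < n.+1) rate 1 (b j) y ^+ 2) ^+ 2)).
  rewrite ler_pXn2r ?nnegrE ?Zn// mulr_ge0// prodr_ge0// => i _; exact: sqr_ge0.
by rewrite exprMn ler_wpM2r ?sqr_ge0.
Qed.

End LogConcave.
End Growth.

(** * The integrals of arsinh and arcosh *)

Section MeanValue.
Variable R : realType.
Implicit Types (f df : R -> R) (a b M : R).

Lemma is_derive_within_continuous f df a b :
  (forall x, a <= x <= b -> is_derive x 1 f (df x)) ->
  {within `[a, b]%classic, continuous f}.
Proof.
move=> h; apply: derivable_within_continuous => x; rewrite in_itv /= => /h hx.
exact: ex_derive.
Qed.

Lemma derive_le_increment f df a b M : a <= b ->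
  (forall x, a <= x <= b -> is_derive x 1 f (df x)) ->
  (forall x, a <= x <= b -> df x <= M) -> f b - f a <= M * (b - a).
Proof.
move=> ab h hM.
have h' x : x \in `]a, b[%R -> is_derive x 1 f (df x).
  by rewrite in_itv /= => /andP[ax xb]; apply: h; rewrite !ltW.
have [x] := MVT_segment ab h' (is_derive_within_continuous h).
by rewrite in_itv /= => /hM dx ->; rewrite ler_wpM2r// subr_ge0.
Qed.

Lemma derive_ge_increment f df a b M : a <= b ->
  (forall x, a <= x <= b -> is_derive x 1 f (df x)) ->
  (forall x, a <= x <= b -> M <= df x) -> M * (b - a) <= f b - f a.
Proof.
move=> ab h hM.
have h' x : x \in `]a, b[%R -> is_derive x 1 f (df x).
  by rewrite in_itv /= => /andP[ax xb]; apply: h; rewrite !ltW.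
have [x] := MVT_segment ab h' (is_derive_within_continuous h).
by rewrite in_itv /= => /hM dx ->; rewrite ler_wpM2r// subr_ge0.
Qed.

End MeanValue.

(** * Logarithmic rates and the integral of 1 / sqrt (1 + u^(2c)) *)

Section Primitives.
Variable R : realType.
Variable c : R.
Hypothesis c_gt1 : 1 < c.
Implicit Types (s u v : R).

Let c_gt0 : 0 < c. Proof. exact: lt_trans c_gt1. Qed.

Definition root2 s u : R := Num.sqrt (1 + s * u `^ (2 * c)).

(* arsinh (u^-c) for s = 1 and arcosh (u^-c) for s = -1. *)
Definition log_rate s u : R := ln (1 + root2 s u) - c * ln u.

Lemma is_derive_powR2 u : 0 < u ->
  is_derive u 1 (fun v => v `^ (2 * c)) (2 * c * (u `^ (2 * c) / u)).
Proof.
move=> u0; apply: (is_derive_eq (is_derive1_powR _ u0)); congr (_ * _).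
apply: (mulfI (lt0r_neq0 u0)); rewrite mulr_powRB1 ?ltW//; last by rewrite mulr_gt0.
by rewrite [RHS]mulrC divfK// gt_eqF.
Qed.

Lemma is_derive_root2 s u : 0 < u -> 0 < 1 + s * u `^ (2 * c) ->
  is_derive u 1 (root2 s) (s * c * u `^ (2 * c) / (u * root2 s u)).
Proof.
move=> u0 r0.
have h1 := is_derive_powR2 u0.
have h2 : is_derive u 1 (cst 1 + (s \*: (fun v : R => v `^ (2 * c))))
   (0 + s *: (2 * c * (u `^ (2 * c) / u))).
  by apply: is_deriveD; apply: is_deriveZ.
have h3 : is_derive ((cst 1 + (s \*: (fun v : R => v `^ (2 * c)))) u) 1 Num.sqrt
   (2 * root2 s u)^-1 by exact: is_derive1_sqrt.
have h4 := is_derive1_comp h3 h2.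
apply: (is_derive_eq h4); rewrite add0r /GRing.scale /=.
have q0 : root2 s u != 0 by rewrite gt_eqF// sqrtr_gt0.
by field; rewrite q0 gt_eqF.
Qed.

Lemma is_derive_log_rate s u : 0 < u -> 0 < 1 + s * u `^ (2 * c) ->
  is_derive u 1 (log_rate s) (- c / (u * root2 s u)).
Proof.
move=> u0 r0; have hq := is_derive_root2 u0 r0.
have q0 : 0 < root2 s u by rewrite sqrtr_gt0.
have h2 : is_derive u 1 (cst 1 + root2 s) (0 + s * c * u `^ (2 * c) / (u * root2 s u)).
  exact: is_deriveD.
have h3 : is_derive ((cst 1 + root2 s) u) 1 (@ln R) (1 + root2 s u)^-1.
  by apply: is_derive1_ln; rewrite addr_gt0.
have h5 : is_derive u 1 (@ln R) u^-1 by exact: is_derive1_ln.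
have h4 := is_deriveB (is_derive1_comp h3 h2) (is_deriveZ c h5).
apply: (is_derive_eq h4); rewrite add0r /GRing.scale /=.
have -> : s * c * u `^ (2 * c) = c * (root2 s u ^+ 2 - 1).
  by rewrite sqr_sqrtr ?(ltW r0)//; ring.
field; do 3?[apply/andP; split] => //; by rewrite gt_eqF// addr_gt0.
Qed.

Lemma root2_gt0 u : 0 < root2 1 u.
Proof. by rewrite sqrtr_gt0 mul1r ltr_wpDr ?powR_ge0. Qed.

Lemma expR_log_rate s u : 0 < u -> expR (log_rate s u) = (1 + root2 s u) / u `^ c.
Proof.
move=> u0; rewrite /log_rate expRD expRN; congr (_ / _).
  by rewrite lnK// posrE ltr_pwDl// sqrtr_ge0.
by rewrite /powR gt_eqF.
Qed.

Lemma log_rate_ge0 s u : 0 < u -> -1 <= s -> u <= 1 -> 0 <= log_rate s u.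
Proof.
move=> u0 s1 u1; rewrite /log_rate subr_ge0 (@le_trans _ _ 0)//.
  by rewrite pmulr_rle0// ln_le0.
by rewrite ln_ge0// lerDl sqrtr_ge0.
Qed.

Lemma log_rate1_ge0 u : 0 < u -> 0 <= log_rate 1 u.
Proof.
move=> u0; rewrite -ler_expR expR0 expR_log_rate// ler_pdivlMr ?powR_gt0// mul1r.
suff : u `^ c <= root2 1 u by lra.
rewrite -[X in X <= _]ger0_norm ?powR_ge0// -sqrtr_sqr ler_wsqrtr//.
by rewrite mul1r mulrC powRrM powR_mulrn ?powR_ge0// lerDr.
Qed.

Lemma log_rate1_le u : 0 < u -> log_rate 1 u <= 2 * u `^ (- c).
Proof.
move=> u0; rewrite -ler_expR (le_trans _ (expR_ge1Dx _))//.
have y0 : 0 < u `^ c by exact: powR_gt0.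
rewrite expR_log_rate// ler_pdivrMr// powRN mulrDl mul1r mulfVK ?gt_eqF//.
suff : root2 1 u <= 1 + u `^ c by lra.
rewrite -[X in _ <= X]ger0_norm ?addr_ge0 ?powR_ge0// -sqrtr_sqr ler_wsqrtr//.
rewrite mul1r mulrC powRrM powR_mulrn ?powR_ge0// sqrrD.
by lra.
Qed.

(* Written as a power so that measurability is immediate. *)
Let inv_root2 u : R := (1 + u `^ (2 * c)) `^ (- 2^-1).

Let inv_root2E u : inv_root2 u = (root2 1 u)^-1.
Proof.
by rewrite /inv_root2 powRN powR12_sqrt ?addr_ge0 ?powR_ge0// /root2 mul1r.
Qed.

Definition prim u : R := parameterized_integral (@lebesgue_measure R) 0 u inv_root2.

Let inv_root2_ge0 u : 0 <= inv_root2 u. Proof. exact: powR_ge0. Qed.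

Let inv_root2_le1 u : inv_root2 u <= 1.
Proof.
rewrite inv_root2E invf_le1 ?root2_gt0// -[X in X <= _]sqrtr1 ler_wsqrtr//.
by rewrite mul1r lerDl powR_ge0.
Qed.

Let integrable_inv_root2 u :
  (@lebesgue_measure R).-integrable `[0, u]%classic (EFin \o inv_root2).
Proof.
apply: measurable_bounded_integrable => //.
- rewrite /= lebesgue_measure_itv/=; case: ifPn => // _.
  by rewrite -EFinB ltry.
- apply: measurable_funTS; apply: (measurableT_comp (measurable_powR _)).
  by apply: measurable_funD => //; exact: measurable_powR.
- exists 1; split => // M M1 t _ /=.
  by rewrite ger0_norm// (le_trans (inv_root2_le1 t))// ltW.
Qed.

Lemma prim_ge0 u : 0 <= prim u.
Proof. by apply: Rintegral_ge0 => t _. Qed.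

Lemma prim_le u : 0 <= u -> prim u <= u.
Proof.
move=> u0; have e : u = \int[@lebesgue_measure R]_(t in `[0, u]%classic) 1.
  rewrite Rintegral_cst//= lebesgue_measure_itv/= mul1r lte_fin.
  by move: u0; rewrite le_eqVlt => /predU1P[<-|->]; rewrite ?ltxx//= subr0.
rewrite [X in _ <= X]e; apply: le_Rintegral => //.
apply: measurable_bounded_integrable => //.
- rewrite /= lebesgue_measure_itv/=; case: ifPn => // _.
  by rewrite -EFinB ltry.
- by exists 1; split => // M M1 t _ /=; rewrite normr1 ltW.
Qed.

Lemma is_derive_prim u : 0 < u -> is_derive u 1 prim (root2 1 u)^-1.
Proof.
move=> u0.
have ct : {for u, continuous inv_root2}.
  have h1 := is_derive_powR2 u0.
  have h2 : is_derive u 1 (cst 1 + (fun v : R => v `^ (2 * c))) (0 + _) := is_deriveD (is_derive_cst _ _ _) h1.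
  have h3 : 0 < (cst 1 + (fun v : R => v `^ (2 * c))) u.
    by rewrite /= ltr_wpDr ?powR_ge0.
  have {}h3 := is_derive1_powR (- 2^-1) h3.
  have [h4 _] := is_derive1_comp h3 h2.
  exact/differentiable_continuous/derivable1_diffP.
have u1 : u < u + 1 by rewrite ltrDl.
have [d e] := continuous_FTC1_closed u1 (integrable_inv_root2 _) u0 ct.
by apply: DeriveDef => //; rewrite -derive1E -inv_root2E e.
Qed.

End Primitives.

Section Integrals.
Variable R : realType.
Variable c : R.
Hypothesis c_gt1 : 1 < c.
Implicit Types (s u v e : R).

Let c_gt0 : 0 < c. Proof. exact: lt_trans c_gt1. Qed.

Lemma powR_le_root2 u : u `^ c <= root2 c 1 u.
Proof.
rewrite -[X in X <= _]ger0_norm ?powR_ge0// -sqrtr_sqr ler_wsqrtr//.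
by rewrite mul1r mulrC powRrM powR_mulrn ?powR_ge0// lerDr.
Qed.

Lemma prim_homo u v : 0 < u -> u <= v -> prim c u <= prim c v.
Proof.
move=> u0 uv; rewrite -subr_ge0 -[X in X <= _](mul0r (v - u)).
apply: (@derive_ge_increment _ _ (fun x => (root2 c 1 x)^-1)) => //.
  by move=> x /andP[ux _]; apply: is_derive_prim => //; exact: lt_le_trans ux.
by move=> x _; rewrite invr_ge0 ltW// root2_gt0.
Qed.

(** On [1, oo) the integrand is at most v^(-c), with antiderivative -v^(1-c) / (c-1); hence prim(v)
    + v^(1-c) / (c-1) is nonincreasing there. *)
Lemma prim_bounded u : prim c u <= 1 + (c - 1)^-1.
Proof.
have c1 : 0 < c - 1 by rewrite subr_gt0.
have [u1|u1] := leP u 1.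
  have [u0|u0] := leP 0 u.
    by rewrite (le_trans (prim_le c u0))// (le_trans u1)// lerDl invr_ge0 ltW.
  rewrite /prim /parameterized_integral set_itv_ge ?Rintegral_set0.
    by rewrite addr_ge0// invr_ge0 ltW.
  by rewrite bnd_simp -ltNge.
have u0 : 0 < u by exact: lt_trans u1.
have : (prim c u + (c - 1)^-1 * u `^ (1 - c)) - (prim c 1 + (c - 1)^-1 * 1 `^ (1 - c)) <=
    0 * (u - 1).
  apply: (@derive_le_increment _ (prim c + ((c - 1)^-1 \*: (fun v : R => v `^ (1 - c))))
    (fun x => (root2 c 1 x)^-1 + (c - 1)^-1 *: ((1 - c) * x `^ (1 - c - 1)))).
  - exact: ltW.
  - move=> x /andP[x1 _]; have x0 : 0 < x by exact: lt_le_trans x1.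
    apply: is_deriveD; first exact: is_derive_prim.
    apply: is_deriveZ; exact: is_derive1_powR.
  - move=> x /andP[x1 _]; have x0 : 0 < x by exact: lt_le_trans x1.
    rewrite /GRing.scale /= mulrA -[1 - c]opprB mulrN mulVf ?gt_eqF//.
    rewrite mulN1r opprB [1 - c - 1]addrAC subrr add0r subr_le0 powRN.
    by rewrite lef_pV2 ?posrE ?root2_gt0 ?powR_gt0// powR_le_root2.
rewrite mul0r powR1 mulr1 => h.
have h1 : prim c 1 <= 1 by exact: prim_le.
have : 0 <= (c - 1)^-1 * u `^ (1 - c) by rewrite mulr_ge0 ?powR_ge0// invr_ge0 ltW.
by lra.
Qed.

(** The constant K: as [prim] is bounded and monotone on the positive axis, its supremum is the
    improper integral. *)
Definition prim_oo : R := sup (range (prim c)).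

Lemma prim_le_oo u : prim c u <= prim_oo.
Proof.
apply: ub_le_sup; last by exists u.
by exists (1 + (c - 1)^-1) => _ [v _ <-]; exact: prim_bounded.
Qed.

Lemma prim_oo_ge0 : 0 <= prim_oo.
Proof. exact: le_trans (prim_ge0 c 1) (prim_le_oo 1). Qed.

Lemma prim_oo_approx e : 0 < e -> exists2 L, 0 < L & forall u, L <= u -> prim_oo - e <= prim c u.
Proof.
move=> e0; have hs : has_sup (range (prim c)).
  split; first by exists (prim c 0), 0.
  by exists (1 + (c - 1)^-1) => _ [v _ <-]; exact: prim_bounded.
have [_ [v _ <-] hv] := sup_adherent e0 hs.
exists (Num.max v 1) => [|u]; first by rewrite lt_max ltr01 orbT.
rewrite ge_max => /andP[vu u1]; rewrite (le_trans (ltW hv))//.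
(* The near-maximal point may be nonpositive; the integral is then over a point or an empty interval
   and vanishes. *)
have [v0|v0] := ltP 0 v; first exact: prim_homo.
suff -> : prim c v = 0 by exact: prim_ge0.
apply/eqP; rewrite eq_le prim_ge0 andbT.
move: v0; rewrite [v <= 0]le_eqVlt => /predU1P[->|v0]; first exact: prim_le.
rewrite /prim /parameterized_integral set_itv_ge ?Rintegral_set0//.
by rewrite bnd_simp -ltNge.
Qed.

Lemma prim_oo_gt0 : 0 < prim_oo.
Proof.
have [h|//] := leP prim_oo 0.
have p0 u : prim c u = 0.
  by apply/eqP; rewrite eq_le prim_ge0 (le_trans (prim_le_oo _)).
have : (root2 c 1 2)^-1 * (2 - 1) <= prim c 2 - prim c 1.
  apply: (@derive_ge_increment _ _ (fun x => (root2 c 1 x)^-1)).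
  - by rewrite ler1n.
  - move=> x /andP[x1 _]; apply: is_derive_prim => //; exact: lt_le_trans x1.
  - move=> x /andP[x1 x2]; rewrite lef_pV2 ?posrE ?root2_gt0//.
    rewrite ler_wsqrtr// lerD2l !mul1r ge0_ler_powR ?nnegrE// ?mulr_ge0// ?ltW//.
    exact: lt_le_trans x1.
rewrite !p0 subrr leNgt pmulr_lgt0 ?invr_gt0 ?root2_gt0// subr_gt0 ltr1n //.
Qed.

Lemma powRN_small a e : 0 < a -> 0 < e ->
  exists2 L, 0 < L & forall u, L <= u -> u `^ (- a) <= e.
Proof.
move=> a0 e0; exists (e `^ (- a^-1)) => [|u hu]; first exact: powR_gt0.
have u0 : 0 < u by apply: lt_le_trans hu; exact: powR_gt0.
have : (e `^ (- a^-1)) `^ a <= u `^ a 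
  by apply: ge0_ler_powR => //; rewrite ?nnegrE ?powR_ge0// ltW.
rewrite -powRrM mulNr mulVf ?gt_eqF// powR_inv1 ?(ltW e0)// powRN => h.
by rewrite -[e]invrK lef_pV2// posrE ?invr_gt0// powR_gt0.
Qed.

(** Shows that the boundary term of the integrations by parts vanishes at 0; the explicit order sqrt
    u comes from -ln u <= 2 / sqrt u. *)
Lemma mul_log_rate_small s u : s <= 1 -> 0 < u -> u <= 1 ->
  u * log_rate c s u <= (2 + 2 * c) * Num.sqrt u.
Proof.
move=> s1 u0 u1.
have su0 : 0 < Num.sqrt u by rewrite sqrtr_gt0.
have su1 : Num.sqrt u <= 1 by rewrite -sqrtr1 ler_wsqrtr.
have uE : Num.sqrt u * Num.sqrt u = u by rewrite -expr2 sqr_sqrtr// ltW.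
have h1 : ln (1 + root2 c s u) <= 2.
  rewrite (le_trans (le_ln1Dx _))//; first by rewrite (lt_le_trans (ltrN10 _))// sqrtr_ge0.
  rewrite -[X in _ <= X]ger0_norm// -sqrtr_sqr ler_wsqrtr//.
  have z0 := powR_ge0 u (2 * c).
  have z1 : u `^ (2 * c) <= 1.
    have : u `^ (2 * c) <= 1 `^ (2 * c); last by rewrite powR1.
    by apply: ge0_ler_powR => //; rewrite ?nnegrE ?mulr_ge0// ltW.
  have : s * u `^ (2 * c) <= 1 by nra.
  by rewrite expr2; lra.
have h2 : - ln u <= 2 / Num.sqrt u.
  have : ln (Num.sqrt u)^-1 <= (Num.sqrt u)^-1 by rewrite ltW// ln_sublinear ?invr_gt0.
  rewrite lnV ?posrE// -{3}uE lnM ?posrE//; lra.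
rewrite /log_rate.
have h3 : u * ln (1 + root2 c s u) <= 2 * Num.sqrt u.
  rewrite -{1}uE; set l := ln _ in h1 *.
  have : Num.sqrt u * l <= 2 by nra.
  by rewrite -mulrA [Num.sqrt u * (_ * _)]mulrC ler_pM2r.
have h4 : u * - ln u <= 2 * Num.sqrt u.
  rewrite (le_trans (ler_wpM2l (ltW u0) h2))// -{1}uE.
  by rewrite mulrCA -mulrA divff ?gt_eqF// mulr1.
have -> : u * (ln (1 + root2 c s u) - c * ln u) =
  u * ln (1 + root2 c s u) + c * (u * - ln u) by ring.
rewrite mulrDl lerD// [2 * c]mulrC -mulrA; exact: ler_wpM2l (ltW c_gt0) _ _ h4.
Qed.

(** The antiderivative of arsinh (u^-c) found by integration by parts: u times the derivative of
    [log_rate] is -c / [root2]. It tends to 0 at 0 and to c K at infinity. *)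
Definition int_arsinh u := u * log_rate c 1 u + c * prim c u.

Lemma is_derive_int_arsinh u : 0 < u -> is_derive u 1 int_arsinh (log_rate c 1 u).
Proof.
move=> u0; have q0 : 0 < 1 + 1 * u `^ (2 * c) by rewrite mul1r ltr_wpDr ?powR_ge0.
have h1 := is_derive_log_rate c_gt1 u0 q0.
have h := is_deriveD (is_deriveM (is_derive_id _ _) h1) (is_deriveZ c (is_derive_prim c_gt1 u0)).
apply: (is_derive_eq h); rewrite /GRing.scale /= mulr1.
by field; rewrite !gt_eqF// root2_gt0.
Qed.

End Integrals.

(** * Limits of the antiderivative of arsinh (u^-c) *)

Section Arsinh.
Variable R : realType.
Variable c : R.
Hypothesis c_gt1 : 1 < c.
Implicit Types (s u v e : R).

Let c_gt0 : 0 < c. Proof. exact: lt_trans c_gt1. Qed.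

Lemma log_rate_homo s u v : 0 < u -> u <= v -> 0 < 1 + s * u `^ (2 * c) ->
  0 < 1 + s * v `^ (2 * c) -> log_rate c s v <= log_rate c s u.
Proof.
move=> u0 uv hu hv; have v0 := lt_le_trans u0 uv.
have H x : u <= x <= v -> 0 < 1 + s * x `^ (2 * c).
  move=> /andP[ux xv]; have x0 := lt_le_trans u0 ux.
  have c2 : 0 <= 2 * c by rewrite mulr_ge0// ltW.
  have h1 : u `^ (2 * c) <= x `^ (2 * c).
    by apply: ge0_ler_powR => //; rewrite nnegrE ltW.
  have h2 : x `^ (2 * c) <= v `^ (2 * c).
    by apply: ge0_ler_powR => //; rewrite nnegrE ltW.
  have [s0|s0] := leP 0 s.
    by rewrite (lt_le_trans hu)// lerD2l ler_wpM2l.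
  by rewrite (lt_le_trans hv)// lerD2l ler_wnM2l// ltW.
rewrite -subr_le0 -[X in _ <= X](mul0r (v - u)).
apply: (@derive_le_increment _ _ (fun x => - c / (x * root2 c s x))) => // x ux.
  have x0 : 0 < x by case/andP: ux => h _; exact: lt_le_trans h.
  exact: is_derive_log_rate (H _ ux).
have x0 : 0 < x by case/andP: ux => h _; exact: lt_le_trans h.
by rewrite mulNr oppr_le0 divr_ge0 ?(ltW c_gt0)// mulr_ge0 ?(ltW x0)// sqrtr_ge0.
Qed.

Lemma int_arsinh_incr u h : 0 < u -> 0 <= h ->
  h * log_rate c 1 (u + h) <= int_arsinh c (u + h) - int_arsinh c u <= h * log_rate c 1 u.
Proof.
move=> u0 h0; have uh : u <= u + h by rewrite lerDl.
have q0 x : 0 < 1 + 1 * x `^ (2 * c) by rewrite mul1r ltr_wpDr ?powR_ge0.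
have H x : u <= x <= u + h -> is_derive x 1 (int_arsinh c) (log_rate c 1 x).
  by move=> /andP[ux _]; apply: is_derive_int_arsinh => //; exact: lt_le_trans ux.
have hE : u + h - u = h by rewrite addrAC subrr add0r.
apply/andP; split.
  rewrite [X in X <= _]mulrC -[X in _ * X <= _]hE.
  apply: (derive_ge_increment uh H) => x /andP[ux xu].
  by apply: log_rate_homo => //; exact: lt_le_trans ux.
rewrite [X in _ <= X]mulrC -[X in _ <= _ * X]hE.
apply: (derive_le_increment uh H) => x /andP[ux xu].
exact: log_rate_homo.
Qed.

Lemma int_arsinh_homo u v : 0 < u -> u <= v -> int_arsinh c u <= int_arsinh c v.
Proof.
move=> u0 uv; have vu : 0 <= v - u by rewrite subr_ge0.
have /andP[h _] := int_arsinh_incr u0 vu; rewrite -subr_ge0.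
have e : u + (v - u) = v by rewrite addrC subrK.
rewrite e in h; apply: le_trans h; rewrite mulr_ge0// log_rate1_ge0//.
exact: lt_le_trans uv.
Qed.

(** By monotonicity u may be replaced by a large v, at which the boundary term is at most 2 v^(1-c),
    hence small. *)
Lemma int_arsinh_le u : 0 < u -> int_arsinh c u <= c * prim_oo c.
Proof.
move=> u0; apply/ler_addgt0Pr => e e0.
have c1 : 0 < c - 1 by rewrite subr_gt0.
have e2 : 0 < e / 2 by rewrite divr_gt0.
have [L L0 hL] := powRN_small c1 e2.
pose v := Num.max u L.
have uv : u <= v by rewrite /v le_max lexx.
have Lv : L <= v by rewrite /v le_max lexx orbT.
have v0 := lt_le_trans u0 uv.
rewrite (le_trans (int_arsinh_homo u0 uv))// /int_arsinh addrC lerD//.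
  by rewrite ler_pM2l// prim_le_oo.
rewrite (le_trans (ler_wpM2l (ltW v0) (log_rate1_le c v0)))//.
have := hL _ Lv; rewrite opprB powRD; last by rewrite (gt_eqF v0) implybT.
by rewrite powRr1 ?(ltW v0)//; lra.
Qed.

Lemma int_arsinh_small e : 0 < e ->
  exists2 d, 0 < d & forall u, 0 < u -> u <= d -> int_arsinh c u <= e.
Proof.
move=> e0; have C0 : 0 < 2 + 3 * c by have := c_gt0; lra.
pose d := Num.min 1 ((e / (2 + 3 * c)) ^+ 2).
exists d => [|u u0]; first by rewrite lt_min ltr01 exprn_gt0// divr_gt0.
rewrite le_min => /andP[u1 ud].
have s0 : 0 <= Num.sqrt u by rewrite sqrtr_ge0.
have su : Num.sqrt u <= e / (2 + 3 * c).
  rewrite -[X in _ <= X]ger0_norm; last by rewrite divr_ge0 ?ltW.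
  by rewrite -sqrtr_sqr ler_wsqrtr.
have su1 : Num.sqrt u <= 1 by rewrite -sqrtr1 ler_wsqrtr.
have uE : Num.sqrt u * Num.sqrt u = u by rewrite -expr2 sqr_sqrtr// ltW.
have h1 := mul_log_rate_small c_gt1 (lexx 1) u0 u1.
have h2 := prim_le c (ltW u0).
apply: (@le_trans _ _ ((2 + 3 * c) * Num.sqrt u)); last first.
  by rewrite mulrC -ler_pdivlMr.
rewrite /int_arsinh.
have -> : (2 + 3 * c) * Num.sqrt u = (2 + 2 * c) * Num.sqrt u + c * Num.sqrt u by ring.
rewrite lerD// ler_pM2l// (le_trans h2)// -{1}uE.
by rewrite -[X in _ <= X]mulr1 ler_wpM2l.
Qed.

Lemma int_arsinh_large e : 0 < e ->
  exists2 L, 0 < L & forall u, L <= u -> c * prim_oo c - e <= int_arsinh c u.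
Proof.
move=> e0; have ec0 : 0 < e / c by rewrite divr_gt0.
have [L L0 hL] := prim_oo_approx c_gt1 ec0; exists L => // u Lu.
have u0 := lt_le_trans L0 Lu.
rewrite /int_arsinh -[X in X <= _]add0r lerD//.
  by rewrite mulr_ge0 ?(ltW u0)// log_rate1_ge0.
have : c * (prim_oo c - e / c) <= c * prim c u by rewrite ler_pM2l// hL.
by rewrite mulrBr [c * (e / c)]mulrC divfK// gt_eqF.
Qed.

End Arsinh.

(** * Doubling on the curve y^2 = x^3 + 1 and the integral of arcosh (u^-c) *)

Section Arcosh.
Variable R : realType.
Variable c : R.
Hypothesis c_gt1 : 1 < c.
Implicit Types (s u v e z : R).

Let c_gt0 : 0 < c. Proof. exact: lt_trans c_gt1. Qed.

Let kap : R := 3 / (2 * c).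

Let kap_gt0 : 0 < kap. Proof. by rewrite divr_gt0// mulr_gt0. Qed.

Let w u := (u `^ (2 * c) + 8) / (4 * (1 - u `^ (2 * c))).

(* With x = u^(2c/3), this is x(2P)^(3/(2c)) for the point P of abscissa -x on
   the curve y^2 = x^3 + 1, where x(2P) = x (x^3 + 8) / (4 (1 - x^3)): doubling
   multiplies dx/y by 2. *)
Definition duplication u := u * w u `^ kap.

Let pow_lt1 u : 0 < u -> u < 1 -> 0 < u `^ (2 * c) < 1.
Proof.
move=> u0 u1; rewrite powR_gt0//=.
have : u `^ (2 * c) < 1 `^ (2 * c).
  by apply: gt0_ltr_powR => //; rewrite ?mulr_gt0// nnegrE ltW.
by rewrite powR1.
Qed.

Let w_ge2 u : 0 < u -> u < 1 -> 2 / (1 - u `^ (2 * c)) <= w u.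
Proof.
move=> u0 u1; have /andP[z0 z1] := pow_lt1 u0 u1.
rewrite /w; set z := u `^ _ in z0 z1 *.
rewrite ler_pdivrMr ?subr_gt0// mulrAC ler_pdivlMr ?mulr_gt0 ?subr_gt0//.
by nra.
Qed.

Let w2 u : 0 < u -> u < 1 -> 2 <= w u.
Proof.
move=> u0 u1; have /andP[z0 z1] := pow_lt1 u0 u1.
rewrite (le_trans _ (w_ge2 u0 u1))// ler_pdivlMr ?subr_gt0//.
by rewrite ler_piMr// gerBl ltW.
Qed.

(** The exponent [kap] makes the 2c-th power of [duplication] equal to z w^3 with z = u^(2c),
    whatever c is. Then 1 + z w^3 = (8 + 20 z - z^2)^2 / (64 (1 - z)^3): the right-hand side is the
    ordinate of 2P in absolute value. *)
Lemma root2_duplication u : 0 < u -> u < 1 ->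
  root2 c 1 (duplication u) =
  (8 + 20 * u `^ (2 * c) - u `^ (2 * c) ^+ 2) /
    (8 * (1 - u `^ (2 * c)) * root2 c (-1) u).
Proof.
move=> u0 u1; have /andP[z0 z1] := pow_lt1 u0 u1.
have w0 : 0 < w u by exact: lt_le_trans (w2 u0 u1).
rewrite /root2 /duplication powRM ?powR_ge0 ?(ltW u0)// -powRrM.
have -> : kap * (2 * c) = 3%:R by rewrite /kap divfK// gt_eqF// mulr_gt0.
rewrite powR_mulrn ?(ltW w0)// /w; set z := u `^ _ in z0 z1 *.
have q0 : 0 < 1 + -1 * z by lra.
set q := Num.sqrt (1 + -1 * z).
have qq : q ^+ 2 = 1 + -1 * z by rewrite sqr_sqrtr// ltW.
have qp : 0 < q by rewrite sqrtr_gt0.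
rewrite -[RHS]ger0_norm; last first.
  rewrite divr_ge0//; first by nra.
  by rewrite !mulr_ge0 ?(ltW qp)// subr_ge0 ltW.
rewrite -sqrtr_sqr; congr Num.sqrt.
rewrite [RHS]expr_div_n [X in _ = _ / X]exprMn qq; field.
by rewrite gt_eqF.
Qed.

Lemma is_derive_duplication u : 0 < u -> u < 1 ->
  is_derive u 1 duplication
    (w u `^ kap * (8 + 20 * u `^ (2 * c) - u `^ (2 * c) ^+ 2) /
      ((u `^ (2 * c) + 8) * (1 - u `^ (2 * c)))).
Proof.
move=> u0 u1; have /andP[z0 z1] := pow_lt1 u0 u1.
have w0 : 0 < w u by exact: lt_le_trans (w2 u0 u1).
have hz := is_derive_powR2 c_gt1 u0.
have hn := is_deriveD hz (is_derive_cst (8 : R) u 1).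
have hd := is_deriveZ (4 : R) (is_deriveB (is_derive_cst (1 : R) u 1) hz).
have d0 : (4 \*: (cst (1 : R) - powR (R:=R)^~ (2 * c))) u != 0.
  by rewrite gt_eqF// mulr_gt0// subr_gt0.
have hw : is_derive u 1 w _ := is_deriveM hn (is_deriveV d0 hd).
have hp := is_derive1_comp (is_derive1_powR kap w0) hw.
have h := is_deriveM (is_derive_id _ _) hp.
apply: (is_derive_eq h).
have -> : w u `^ (kap - 1) = w u `^ kap / w u.
  apply: (mulfI (lt0r_neq0 w0)); rewrite mulr_powRB1 ?(ltW w0)//.
  by rewrite mulrC divfK// gt_eqF.
rewrite !fctE /= /kap /GRing.scale /= ?mulr1.
have -> : w u = (u `^ (2 * c) + 8) / (4 * (1 - u `^ (2 * c))) by [].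
set W := powR (_ / _) _.
set z := u `^ _ in z0 z1 *.
field; do 5?[apply/andP; split] => //; rewrite ?gt_eqF//; lra.
Qed.

(** The factor 8 + 20 z - z^2 of the derivative of [duplication] cancels against
    [root2_duplication]. For c = 3/2 the power of w is 1, and this is the rule that doubling
    multiplies dx/y by 2. *)
Lemma is_derive_prim_duplication u : 0 < u -> u < 1 ->
  is_derive u 1 (prim c \o duplication) (2 * (w u `^ (kap - 1)) / root2 c (-1) u).
Proof.
move=> u0 u1; have /andP[z0 z1] := pow_lt1 u0 u1.
have w0 : 0 < w u by exact: lt_le_trans (w2 u0 u1).
have U0 : 0 < duplication u by rewrite mulr_gt0// powR_gt0.
have h := is_derive1_comp (is_derive_prim c_gt1 U0) (is_derive_duplication u0 u1).
apply: (is_derive_eq h); rewrite root2_duplication//.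
have -> : w u `^ (kap - 1) = w u `^ kap / w u.
  apply: (mulfI (lt0r_neq0 w0)); rewrite mulr_powRB1 ?(ltW w0)//.
  by rewrite mulrC divfK// gt_eqF.
have q0 : 0 < root2 c (-1) u by rewrite sqrtr_gt0; lra.
have qq : 1 - u `^ (2 * c) = root2 c (-1) u ^+ 2 by rewrite sqr_sqrtr; lra.
move: (w u `^ kap) => W; rewrite /w qq; move: (root2 c (-1) u) q0 qq => q q0 qq.
have -> : u `^ (2 * c) = 1 - q ^+ 2 by rewrite -qq; ring.
have q1 : q ^+ 2 < 1 by lra.
field; do 5?[apply/andP; split] => //; rewrite ?gt_eqF//; try lra; nra.
Qed.

(** The constant lambda. As w >= 2, the quantity lambda w^(kap-1) = (w/2)^(kap-1) is at most 1 for c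
    >= 3/2 and at least 1 for c <= 3/2. *)
Definition arcosh_factor : R := 2 `^ (1 - kap).

Lemma arcosh_factor_gt0 : 0 < arcosh_factor.
Proof. exact: powR_gt0. Qed.

Lemma arcosh_factor_gt1 : 3 / 2 < c -> 1 < arcosh_factor.
Proof.
move=> c32; have k1 : kap < 1 by rewrite /kap ltr_pdivrMr ?mulr_gt0//; lra.
have : 1 `^ (1 - kap) < arcosh_factor; last by rewrite powR1.
by apply: gt0_ltr_powR; rewrite ?nnegrE ?subr_gt0// ltr1n.
Qed.

Lemma arcosh_factor_lt1 : c < 3 / 2 -> arcosh_factor < 1.
Proof.
move=> c32; have k1 : 1 < kap by rewrite /kap ltr_pdivlMr ?mulr_gt0//; lra.
rewrite /arcosh_factor -opprB powRN invf_lt1 ?powR_gt0//.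
have : 1 `^ (kap - 1) < 2 `^ (kap - 1); last by rewrite powR1.
by apply: gt0_ltr_powR; rewrite ?nnegrE ?subr_gt0// ltr1n.
Qed.

(* Replaces, in the derivative of [prim c \o duplication], the power w^(3/(2c) - 1)
   by its extreme value 2^(3/(2c) - 1): the result is an antiderivative of
   arcosh (u^-c) for c = 3/2, and errs on the useful side for other c. *)
Definition int_arcosh u :=
  u * log_rate c (-1) u + c * arcosh_factor / 2 * prim c (duplication u).

Lemma is_derive_int_arcosh u : 0 < u -> u < 1 ->
  is_derive u 1 int_arcosh (log_rate c (-1) u +
    c / root2 c (-1) u * (arcosh_factor * w u `^ (kap - 1) - 1)).
Proof.
move=> u0 u1; have /andP[z0 z1] := pow_lt1 u0 u1.
have q0 : 0 < 1 + -1 * u `^ (2 * c) by lra.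
have r0 : 0 < root2 c (-1) u by rewrite sqrtr_gt0.
have h1 := is_derive_log_rate c_gt1 u0 q0.
have h2 := is_derive_prim_duplication u0 u1.
have h := is_deriveD (is_deriveM (is_derive_id _ _) h1)
  (is_deriveZ (c * arcosh_factor / 2) h2).
apply: (is_derive_eq h); rewrite /GRing.scale /= mulr1.
by field; rewrite !gt_eqF.
Qed.

Let factor_le u : 0 < u -> u < 1 -> 3 / 2 <= c -> arcosh_factor * w u `^ (kap - 1) <= 1.
Proof.
move=> u0 u1 c32; have k1 : kap <= 1 by rewrite /kap ler_pdivrMr ?mulr_gt0//; lra.
have w0 : 0 < w u by exact: lt_le_trans (w2 u0 u1).
rewrite -[kap - 1]opprB powRN ler_pdivrMr ?powR_gt0// mul1r.
apply: ge0_ler_powR; rewrite ?nnegrE ?subr_ge0// ?(ltW w0)//.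
exact: w2.
Qed.

Let factor_ge u : 0 < u -> u < 1 -> c <= 3 / 2 -> 1 <= arcosh_factor * w u `^ (kap - 1).
Proof.
move=> u0 u1 c32; have k1 : 1 <= kap by rewrite /kap ler_pdivlMr ?mulr_gt0//; lra.
have w0 : 0 < w u by exact: lt_le_trans (w2 u0 u1).
rewrite /arcosh_factor -opprB powRN mulrC ler_pdivlMr ?powR_gt0// mul1r.
apply: ge0_ler_powR; rewrite ?nnegrE ?subr_ge0// ?(ltW w0)//.
exact: w2.
Qed.

Let root2N_gt0 u : 0 < u -> u < 1 -> 0 < 1 + -1 * u `^ (2 * c).
Proof. by move=> u0 u1; have /andP[z0 z1] := pow_lt1 u0 u1; lra. Qed.

Lemma int_arcosh_incr_le u h : 3 / 2 <= c -> 0 < u -> 0 <= h -> u + h < 1 ->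
  int_arcosh (u + h) - int_arcosh u <= h * log_rate c (-1) u.
Proof.
move=> c32 u0 h0 uh1; have uh : u <= u + h by rewrite lerDl.
have hE : u + h - u = h by rewrite addrAC subrr add0r.
have H x : u <= x <= u + h -> is_derive x 1 int_arcosh (log_rate c (-1) x +
    c / root2 c (-1) x * (arcosh_factor * w x `^ (kap - 1) - 1)).
  move=> /andP[ux xu]; apply: is_derive_int_arcosh; first exact: lt_le_trans ux.
  exact: le_lt_trans uh1.
rewrite [X in _ <= X]mulrC -[X in _ <= _ * X]hE.
apply: (derive_le_increment uh H) => x /andP[ux xu].
have x0 := lt_le_trans u0 ux; have x1 := le_lt_trans xu uh1.
have u1 := le_lt_trans ux x1.
rewrite -[X in _ <= X]addr0 lerD//.
  by apply: log_rate_homo => //; exact: root2N_gt0.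
rewrite mulr_ge0_le0 ?divr_ge0 ?sqrtr_ge0 ?(ltW c_gt0)//.
by rewrite subr_le0 factor_le.
Qed.

Lemma int_arcosh_incr_ge u h : c <= 3 / 2 -> 0 < u -> 0 <= h -> u + h < 1 ->
  h * log_rate c (-1) (u + h) <= int_arcosh (u + h) - int_arcosh u.
Proof.
move=> c32 u0 h0 uh1; have uh : u <= u + h by rewrite lerDl.
have hE : u + h - u = h by rewrite addrAC subrr add0r.
have H x : u <= x <= u + h -> is_derive x 1 int_arcosh (log_rate c (-1) x +
    c / root2 c (-1) x * (arcosh_factor * w x `^ (kap - 1) - 1)).
  move=> /andP[ux xu]; apply: is_derive_int_arcosh; first exact: lt_le_trans ux.
  exact: le_lt_trans uh1.
rewrite [X in X <= _]mulrC -[X in _ * X <= _]hE.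
apply: (derive_ge_increment uh H) => x /andP[ux xu].
have x0 := lt_le_trans u0 ux; have x1 := le_lt_trans xu uh1.
rewrite -[X in X <= _]addr0 lerD//.
  by apply: log_rate_homo => //; apply: root2N_gt0 => //; exact: lt_le_trans uh.
by rewrite mulr_ge0 ?divr_ge0 ?sqrtr_ge0 ?(ltW c_gt0)// subr_ge0 factor_ge.
Qed.

Lemma log_rateN1_ge0 u : 0 < u -> u < 1 -> 0 <= log_rate c (-1) u.
Proof. by move=> u0 u1; apply: log_rate_ge0 => //; exact: ltW. Qed.

Lemma int_arcosh_ge u : 0 < u -> u * log_rate c (-1) u <= int_arcosh u.
Proof.
move=> u0; rewrite /int_arcosh lerDl mulr_ge0 ?prim_ge0// divr_ge0//.
by rewrite mulr_ge0 ?(ltW c_gt0) ?(ltW arcosh_factor_gt0).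
Qed.

Lemma log_rateN1_near1 u e : u < 1 -> 0 < e ->
  exists2 v, u < v < 1 & log_rate c (-1) v <= e.
Proof.
move=> u1 e0; wlog u0 : u u1 / 0 < u => [hw|].
  have [|u0] := ltP 0 u; first exact: hw.
  have h1 : 1 / 2 < 1 :> R by lra.
  have h2 : 0 < 1 / 2 :> R by lra.
  have [v /andP[v0 v1] hv] := hw _ h1 h2.
  by exists v => //; rewrite v1 andbT; apply: le_lt_trans u0 _; exact: lt_trans h2 v0.
have lu : 0 < - ln u by rewrite oppr_gt0 ln_lt0// u0.
(* The point is v = e^(-t). The three bounds on t give u < v, then 1 - v^(2c) <= 2 c t <= (e/2)^2
   for the square root, and -c ln v = c t <= e/2. *)
pose t := Num.min (- ln u / 2) (Num.min (e ^+ 2 / (8 * c)) (e / (2 * c))).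
have t0 : 0 < t by rewrite !lt_min !divr_gt0 ?exprn_gt0 ?mulr_gt0.
have t1 : t <= - ln u / 2 by rewrite /t ge_min lexx.
have t2 : 2 * c * t <= (e / 2) ^+ 2.
  have : t <= e ^+ 2 / (8 * c) by rewrite /t !ge_min lexx !orbT.
  by rewrite ler_pdivlMr ?mulr_gt0// expr_div_n; lra.
have t3 : c * t <= e / 2.
  have : t <= e / (2 * c) by rewrite /t !ge_min lexx !orbT.
  by rewrite ler_pdivlMr ?mulr_gt0//; lra.
have v0 := expR_gt0 (- t).
exists (expR (- t)).
  rewrite -{1}[u]lnK ?posrE// ltr_expR -[X in _ && (_ < X)]expR0 ltr_expR.
  by apply/andP; split; lra.
have z1 : 1 - 2 * c * t <= expR (- t) `^ (2 * c).
  by rewrite -expRM (le_trans _ (expR_ge1Dx _))//; lra.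
rewrite /log_rate expRK.
have h1 : root2 c (-1) (expR (- t)) <= e / 2.
  rewrite -[X in _ <= X]ger0_norm; last by rewrite divr_ge0// ltW.
  by rewrite -sqrtr_sqr ler_wsqrtr//; lra.
have h2 : ln (1 + root2 c (-1) (expR (- t))) <= root2 c (-1) (expR (- t)).
  by apply: le_ln1Dx; rewrite (lt_le_trans (ltrN10 _))// sqrtr_ge0.
lra.
Qed.

Lemma int_arcosh_le u : c <= 3 / 2 -> 0 < u -> u < 1 ->
  int_arcosh u <= c * arcosh_factor / 2 * prim_oo c.
Proof.
move=> c32 u0 u1; apply/ler_addgt0Pr => e e0.
have [v /andP[uv v1] hv] := log_rateN1_near1 u1 e0.
have v0 := lt_trans u0 uv.
have vu : 0 <= v - u by rewrite subr_ge0 ltW.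
have vE : u + (v - u) = v by rewrite addrC subrK.
have := int_arcosh_incr_ge c32 u0 vu; rewrite vE => /(_ v1) h.
have hl : 0 <= (v - u) * log_rate c (-1) v by rewrite mulr_ge0// log_rateN1_ge0.
have : int_arcosh u <= int_arcosh v by rewrite -subr_ge0 (le_trans hl).
move=> /le_trans; apply; rewrite addrC /int_arcosh lerD//.
  by rewrite (le_trans _ hv)// ler_piMl ?log_rateN1_ge0// ltW.
rewrite ler_wpM2l ?prim_le_oo// divr_ge0// mulr_ge0//.
  exact: ltW.
exact: ltW arcosh_factor_gt0.
Qed.

Lemma int_arcosh_near1 e : 0 < e -> exists2 d, 0 < d < 1 &
  forall u, d <= u -> u < 1 -> c * arcosh_factor / 2 * prim_oo c - e <= int_arcosh u.
Proof.
move=> e0; have f0 := arcosh_factor_gt0.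
have C0 : 0 < c * arcosh_factor / 2 by rewrite divr_gt0// mulr_gt0.
have [L L0 hL] := prim_oo_approx c_gt1 (divr_gt0 e0 C0).
(* If w >= W and u >= 1/2, then [duplication u] = u w^kap >= L. For w >= W it suffices that u^(2c)
   >= 1 - 2/W, by [w_ge2]; this is what u >= e^(-1/(cW)) ensures. *)
pose W := (2 * L) `^ kap^-1.
have W0 : 0 < W by rewrite powR_gt0// mulr_gt0.
have cW0 : 0 < c * W by rewrite mulr_gt0.
exists (Num.max 2^-1 (expR (- (c * W)^-1))).
  rewrite lt_max expR_gt0 orbT/= gt_max invf_lt1 ?ltr1n//= -[X in _ < X]expR0 ltr_expR.
  by rewrite oppr_lt0 invr_gt0.
move=> u; rewrite ge_max => /andP[u2 hu] u1.
have u0 : 0 < u by apply: lt_le_trans u2; rewrite invr_gt0.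
have /andP[z0 z1] := pow_lt1 u0 u1.
have hz : 1 - 2 / W <= u `^ (2 * c).
  have : - (c * W)^-1 <= ln u by rewrite -ler_expR lnK ?posrE.
  rewrite invfM /powR gt_eqF// => h.
  rewrite (le_trans _ (expR_ge1Dx _))// lerD2l.
  have : 2 * c * (- (c^-1 * W^-1)) <= 2 * c * ln u by rewrite ler_pM2l ?mulr_gt0.
  by apply: le_trans; rewrite mulrN -mulrA mulVKf ?gt_eqF.
have hw : W <= w u.
  rewrite (le_trans _ (w_ge2 u0 u1))// ler_pdivlMr ?subr_gt0// mulrC -ler_pdivlMr//.
  by lra.
have hU : L <= duplication u.
  have : 2 * L <= w u `^ kap.
    have -> : 2 * L = W `^ kap.
      by rewrite /W -powRrM mulVf ?gt_eqF// powRr1// mulr_ge0// ltW.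
    by apply: ge0_ler_powR; rewrite ?nnegrE ?(ltW W0) ?(ltW kap_gt0)// (le_trans (ltW W0)).
  by rewrite /duplication; nra.
rewrite /int_arcosh -[X in X <= _]add0r lerD//.
  by rewrite mulr_ge0 ?(ltW u0)// log_rateN1_ge0.
have : c * arcosh_factor / 2 * (prim_oo c - e / (c * arcosh_factor / 2)) <=
    c * arcosh_factor / 2 * prim c (duplication u) by rewrite ler_pM2l// hL.
by rewrite mulrBr [X in _ - X <= _]mulrC divfK// gt_eqF.
Qed.

Lemma int_arcosh_small e : 0 < e ->
  exists2 d, 0 < d < 1 & forall u, 0 < u -> u <= d -> int_arcosh u <= e.
Proof.
move=> e0; have f0 := arcosh_factor_gt0.
(* The constant 2 + 2c is that of [mul_log_rate_small]; for u <= 1/2 one has w <= 5, whence the last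
   term. *)
pose D := 2 + 2 * c + c * arcosh_factor / 2 * 5 `^ kap.
have C0 : 0 <= c * arcosh_factor / 2 by rewrite divr_ge0// mulr_ge0// ltW.
have D0 : 0 < D.
  have : 0 <= c * arcosh_factor / 2 * 5 `^ kap by rewrite mulr_ge0// powR_ge0.
  by move=> /(ltr_wpDr); apply; have := c_gt0; lra.
exists (Num.min (1 / 2) ((e / D) ^+ 2)) => [|u u0].
  rewrite lt_min gt_min exprn_gt0 ?divr_gt0//=.
  by rewrite ltr_pdivrMr// mul1r ltr1n.
rewrite le_min => /andP[u1 ud].
have u_lt1 : u < 1 by lra.
have /andP[z0 z1] := pow_lt1 u0 u_lt1.
have s0 : 0 <= Num.sqrt u by rewrite sqrtr_ge0.
have su : Num.sqrt u <= e / D.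
  rewrite -[X in _ <= X]ger0_norm; last by rewrite divr_ge0 ?ltW.
  by rewrite -sqrtr_sqr ler_wsqrtr.
have su1 : Num.sqrt u <= 1 by rewrite -sqrtr1 ler_wsqrtr// ltW.
have uE : Num.sqrt u * Num.sqrt u = u by rewrite -expr2 sqr_sqrtr// ltW.
have h1 := mul_log_rate_small c_gt1 (le_trans (lerN10 R) ler01) u0 (ltW u_lt1).
have z2 : u `^ (2 * c) <= 1 / 2.
  rewrite (le_trans _ u1)// ge1r_powR ?u0 ?(ltW u_lt1)//.
  by have := c_gt1; lra.
have w5 : w u <= 5.
  by rewrite /w ler_pdivrMr ?mulr_gt0 ?subr_gt0//; lra.
have w0 : 0 < w u by exact: lt_le_trans (w2 u0 u_lt1).
have h2 : duplication u <= 5 `^ kap * Num.sqrt u.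
  rewrite /duplication mulrC; apply: ler_pM => //; rewrite ?powR_ge0 ?(ltW u0)//.
    by apply: ge0_ler_powR; rewrite ?nnegrE ?(ltW kap_gt0) ?(ltW w0).
  by rewrite -{1}uE -[X in _ <= X]mulr1 ler_wpM2l.
apply: (@le_trans _ _ (D * Num.sqrt u)); last first.
  by rewrite mulrC -ler_pdivlMr.
have h3 : prim c (duplication u) <= 5 `^ kap * Num.sqrt u.
  rewrite (le_trans (prim_le c _))//.
  by rewrite /duplication mulr_ge0 ?powR_ge0// ltW.
rewrite /int_arcosh /D mulrDl lerD// -[X in _ <= X]mulrA.
by rewrite ler_wpM2l.
Qed.

End Arcosh.

(** * Asymptotics for b_n = (c (n + 1))^c *)

Section PowerCoef.
Variable R : realType.
Variable c : R.
Hypothesis c_gt1 : 1 < c.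
Implicit Types (s e T : R) (n m k : nat).

Let c_gt0 : 0 < c. Proof. exact: lt_trans c_gt1. Qed.

Let b := power_coef c.
Let K := prim_oo c.

Lemma power_coefE n : power_coef c n = (c * n.+1%:R) `^ c.
Proof. by rewrite /power_coef powRM ?ltW. Qed.

Lemma power_coef_gt0 n : 0 < power_coef c n.
Proof. by rewrite power_coefE powR_gt0// mulr_gt0. Qed.

Lemma power_coef_le n : power_coef c n <= power_coef c n.+1.
Proof.
rewrite !power_coefE; apply: ge0_ler_powR; rewrite ?nnegrE ?mulr_ge0 ?(ltW c_gt0)//.
by rewrite ler_pM2l// ler_nat.
Qed.

Lemma power_coef_logconcave n :
  power_coef c n.+2 * power_coef c n <= power_coef c n.+1 ^+ 2.
Proof.
rewrite expr2 !power_coefE -!powRM ?mulr_ge0 ?(ltW c_gt0)//.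
apply: ge0_ler_powR; rewrite ?nnegrE ?mulr_ge0 ?(ltW c_gt0)//.
rewrite mulrACA [X in _ <= X]mulrACA ler_pM2l ?mulr_gt0// -!natrM ler_nat.
by rewrite !mulSn !mulnS; lia.
Qed.

(** By homogeneity the rate depends only on b_n / T^c = u^c with u = c (n+1) / T. Products of rates
    thus become exponentials of Riemann sums of mesh c / T. *)
Lemma rate_power_coef s T n : 0 < T ->
  rate s (power_coef c n) (2 * T `^ c) = expR (log_rate c s (c / T * n.+1%:R)).
Proof.
move=> T0; have u0 : 0 < c / T * n.+1%:R by rewrite mulr_gt0// divr_gt0.
rewrite expR_log_rate// power_coefE /rate /root2.
have Tc : 0 < T `^ c by exact: powR_gt0.
have -> : (c * n.+1%:R) `^ c = T `^ c * (c / T * n.+1%:R) `^ c.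
  rewrite -powRM ?(ltW T0) ?(ltW u0)//; congr (_ `^ _).
  by rewrite mulrA [T * _]mulrC divfK// gt_eqF.
have -> : (c / T * n.+1%:R) `^ (2 * c) = ((c / T * n.+1%:R) `^ c) ^+ 2.
  by rewrite [2 * c]mulrC powRrM powR_mulrn ?powR_ge0.
set v := (c / T * n.+1%:R) `^ c; have v0 : 0 < v by exact: powR_gt0.
have -> : (2 * T `^ c) ^+ 2 + s * (4 * (T `^ c * v) ^+ 2) =
   (2 * T `^ c) ^+ 2 * (1 + s * v ^+ 2) by ring.
rewrite sqrtrM ?sqr_ge0// sqrtr_sqr ger0_norm; last by rewrite mulr_ge0// ltW.
by field; rewrite !gt_eqF.
Qed.

Lemma prod_rateE s T n : 0 < T -> \prod_(j < n) rate s (power_coef c j) (2 * T `^ c) =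
  expR (\sum_(j < n) log_rate c s (c / T * j.+1%:R)).
Proof.
by move=> T0; rewrite expR_sum; apply: eq_bigr => j _; exact: rate_power_coef.
Qed.

(** Right endpoint sums of a decreasing function lie below its integral. The integrand is unbounded
    at 0, so the first cell is read off from the formula for [int_arsinh]. *)
Lemma sum_arsinh_le_int h n : 0 < h ->
  h * (\sum_(j < n.+1) log_rate c 1 (h * j.+1%:R)) <= int_arsinh c (h * n.+1%:R).
Proof.
move=> h0; elim: n => [|n IH].
  by rewrite big_ord1 mulr1 /int_arsinh lerDl mulr_ge0 ?prim_ge0 ?(ltW c_gt0).
have -> : \sum_(j < n.+2) log_rate c 1 (h * j.+1%:R) =
    \sum_(j < n.+1) log_rate c 1 (h * j.+1%:R) + log_rate c 1 (h * n.+2%:R).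
    by rewrite big_ord_recr.
  rewrite [X in X <= _]mulrDr; have u0 : 0 < h * n.+1%:R by rewrite mulr_gt0.
have := int_arsinh_incr c_gt1 u0 (ltW h0).
have -> : h * n.+1%:R + h = h * n.+2%:R by rewrite -[X in _ = _ * X]natr1 mulrDr mulr1.
by move=> /andP[h1 _]; have := lerD IH h1; rewrite [X in _ <= X]addrC subrK.
Qed.

Lemma sum_arsinh_le T n : 0 < T ->
  \sum_(j < n) log_rate c 1 (c / T * j.+1%:R) <= T * K.
Proof.
move=> T0; have h0 : 0 < c / T by rewrite divr_gt0.
case: n => [|n]; first by rewrite big_ord0 mulr_ge0 ?(ltW T0)// prim_oo_ge0.
have u0 : 0 < c / T * n.+1%:R by rewrite mulr_gt0.
have := le_trans (sum_arsinh_le_int n h0) (int_arsinh_le c_gt1 u0).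
rewrite mulrAC -ler_pdivlMr//; last by rewrite invr_gt0.
by rewrite invrK -mulrA ler_pM2l// [K * T]mulrC.
Qed.

Lemma sum_arsinh_ge T n : 0 < T ->
  T / c * (int_arsinh c (c / T * n.+1%:R) - int_arsinh c (c / T)) <=
  \sum_(j < n) log_rate c 1 (c / T * j.+1%:R).
Proof.
move=> T0; have h0 : 0 < c / T by rewrite divr_gt0.
rewrite -[T / c]invf_div [(c / T)^-1 * _]mulrC ler_pdivrMr// [X in _ <= X]mulrC.
elim: n => [|n IH]; first by rewrite mulr1 subrr big_ord0 mulr0.
have -> : \sum_(j < n.+1) log_rate c 1 ((c / T) * j.+1%:R) =
    \sum_(j < n) log_rate c 1 ((c / T) * j.+1%:R) + log_rate c 1 ((c / T) * n.+1%:R).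
    by rewrite big_ord_recr.
  rewrite [X in _ <= X]mulrDr; have u0 : 0 < c / T * n.+1%:R by rewrite mulr_gt0.
have := int_arsinh_incr c_gt1 u0 (ltW h0).
have -> : c / T * n.+1%:R + c / T = c / T * n.+2%:R.
  by rewrite -[X in _ = _ * X]natr1 mulrDr mulr1.
have tel (x y z : R) : x - y + (z - x) = z - y by ring.
by move=> /andP[_ h1]; have := lerD IH h1; rewrite tel.
Qed.

Lemma sum_arsinh_tail T m n : 0 < T -> (m < n)%N ->
  \sum_(m.+1 <= j < n) log_rate c 1 (c / T * j.+1%:R) <=
  T / c * (c * K - int_arsinh c (c / T * m.+1%:R)).
Proof.
move=> T0 mn; have h0 : 0 < c / T by rewrite divr_gt0.
have u0 k : 0 < c / T * k.+1%:R by rewrite mulr_gt0.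
rewrite -[T / c]invf_div [(c / T)^-1 * _]mulrC ler_pdivlMr// [X in X <= _]mulrC.
apply: (@le_trans _ _ (int_arsinh c (c / T * n%:R) - int_arsinh c (c / T * m.+1%:R))); last first.
  by rewrite lerD2r; case: n mn => // n _; exact: int_arsinh_le.
elim: n mn => [//|n IH]; rewrite ltnS leq_eqVlt => /predU1P[<-|mn].
  by rewrite big_geq// mulr0 subrr.
rewrite big_nat_recr//= mulrDr.
have n0 : (0 < n)%N by exact: leq_ltn_trans mn.
have un : 0 < c / T * n%:R by rewrite mulr_gt0// ltr0n.
have := int_arsinh_incr c_gt1 un (ltW h0).
have -> : c / T * n%:R + c / T = c / T * n.+1%:R.
  by rewrite -[X in _ = _ * X]natr1 mulrDr mulr1.
move=> /andP[h1 _]; have := IH mn; move: h1.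
by set S := \sum_(_ <= _ < _) _; lra.
Qed.

Lemma sum_arcosh_ge T n : 3 / 2 <= c -> 0 < T -> c / T * n.+1%:R < 1 ->
  T / c * (int_arcosh c (c / T * n.+1%:R) - int_arcosh c (c / T)) <=
  \sum_(j < n) log_rate c (-1) (c / T * j.+1%:R).
Proof.
move=> c32 T0; have h0 : 0 < c / T by rewrite divr_gt0.
rewrite -[T / c]invf_div [(c / T)^-1 * _]mulrC ler_pdivrMr// [X in _ <= X]mulrC.
elim: n => [|n IH] n1; first by rewrite mulr1 subrr big_ord0 mulr0.
have -> : \sum_(j < n.+1) log_rate c (-1) ((c / T) * j.+1%:R) =
    \sum_(j < n) log_rate c (-1) ((c / T) * j.+1%:R) + log_rate c (-1) ((c / T) * n.+1%:R).
    by rewrite big_ord_recr.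
  rewrite [X in _ <= X]mulrDr; have u0 : 0 < c / T * n.+1%:R by rewrite mulr_gt0.
have e : c / T * n.+1%:R + c / T = c / T * n.+2%:R.
  by rewrite -[X in _ = _ * X]natr1 mulrDr mulr1.
have := int_arcosh_incr_le c_gt1 c32 u0 (ltW h0); rewrite e => /(_ n1) h1.
have n1' : c / T * n.+1%:R < 1 by apply: lt_trans n1; rewrite ltr_pM2l// ltr_nat.
have tel (x y z : R) : x - y + (z - x) = z - y by ring.
by have := lerD (IH n1') h1; rewrite tel.
Qed.

Lemma sum_arcosh_le T n : c <= 3 / 2 -> 0 < T -> c / T * n%:R < 1 ->
  \sum_(j < n) log_rate c (-1) (c / T * j.+1%:R) <= T * (arcosh_factor c / 2 * K).
Proof.
move=> c32 T0; have h0 : 0 < c / T by rewrite divr_gt0.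
case: n => [_|n n1].
  rewrite big_ord0 mulr_ge0 ?(ltW T0)// mulr_ge0 ?prim_oo_ge0// divr_ge0//.
  exact: ltW (arcosh_factor_gt0 _).
have u0 k : 0 < c / T * k.+1%:R by rewrite mulr_gt0.
have H : c / T * (\sum_(j < n.+1) log_rate c (-1) (c / T * j.+1%:R)) <=
    int_arcosh c (c / T * n.+1%:R).
  elim: n n1 => [|n IH] n1.
    rewrite big_ord1 mulr1; exact: int_arcosh_ge.
  have -> : \sum_(j < n.+2) log_rate c (-1) ((c / T) * j.+1%:R) =
    \sum_(j < n.+1) log_rate c (-1) ((c / T) * j.+1%:R) + log_rate c (-1) ((c / T) * n.+2%:R).
    by rewrite big_ord_recr.
  rewrite [X in X <= _]mulrDr.
  have e : c / T * n.+1%:R + c / T = c / T * n.+2%:R.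
    by rewrite -[X in _ = _ * X]natr1 mulrDr mulr1.
  have := int_arcosh_incr_ge c_gt1 c32 (u0 n) (ltW h0); rewrite e => /(_ n1) h1.
  have n1' : c / T * n.+1%:R < 1 by apply: lt_trans n1; rewrite ltr_pM2l// ltr_nat.
  by have := lerD (IH n1') h1; rewrite [X in _ <= X]addrC subrK.
have := le_trans H (int_arcosh_le c_gt1 c32 (u0 n) n1).
rewrite mulrAC -ler_pdivlMr//; last by rewrite invr_gt0.
have -> : c * arcosh_factor c / 2 * prim_oo c / T^-1 = c * (T * (arcosh_factor c / 2 * K)).
  by rewrite invrK /K; ring.
by rewrite ler_pM2l.
Qed.

End PowerCoef.

(** * Exponential bounds for q_n, and for P_n from below *)

Section Asymptotics.
Variable R : realType.
Variable c : R.
Hypothesis c_gt1 : 1 < c.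
Implicit Types (s e T L : R) (n m k : nat).

Let c_gt0 : 0 < c. Proof. exact: lt_trans c_gt1. Qed.

Let b := power_coef c.
Let b_gt0 n : 0 < b n. Proof. exact: power_coef_gt0. Qed.
Let b_le n : b n <= b n.+1. Proof. exact: power_coef_le. Qed.
Let b_logconcave n : b n.+2 * b n <= b n.+1 ^+ 2.
Proof. exact: power_coef_logconcave. Qed.
Let K := prim_oo c.

Let arg_gt0 T : 0 < T -> 0 < 2 * T `^ c.
Proof. by move=> T0; rewrite mulr_gt0// powR_gt0. Qed.

Lemma abs_orthopoly_le_expR T n : 0 < T ->
  (abs_orthopoly b n).[2 * T `^ c] <= expR (T * K).
Proof.
move=> T0; rewrite (le_trans (abs_orthopoly_le_prod b_gt0 b_le n (arg_gt0 T0)))//.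
by rewrite prod_rateE// ler_expR sum_arsinh_le.
Qed.

Lemma abs_orthopoly_ge_expR e : 0 < e -> exists T0 C, [/\ 0 < T0, 0 < C &
  forall T, T0 <= T -> exists m,
    C * expR (T * (K - e)) <= (abs_orthopoly b m.*2).[2 * T `^ c]].
Proof.
move=> e0; have e1 : 0 < c * e / 2 by rewrite divr_gt0// mulr_gt0.
have [L L0 hL] := int_arsinh_large c_gt1 e1.
have [d d0 hd] := int_arsinh_small c_gt1 e1.
(* From T >= c/d on, the mesh c/T is at most d. The constant C bounds the prefactor y / b_n = 2 /
   u^c of [abs_orthopoly_ge_prod] from below, where u = (c/T)(n+1) <= 2 (L + d). *)
exists (c / d), (2 / (2 * (L + d)) `^ c); split.
- by rewrite divr_gt0.
- by rewrite divr_gt0// powR_gt0// mulr_gt0// addr_gt0.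
move=> T hT; have T0 : 0 < T by apply: lt_le_trans hT; rewrite divr_gt0.
have h0 : 0 < c / T by rewrite divr_gt0.
have hd' : c / T <= d by rewrite ler_pdivrMr// mulrC -ler_pdivrMr.
have Lh0 : 0 <= L / (c / T) by rewrite divr_ge0// ltW.
have /andP[k1 k2] := truncn_itv Lh0.
(* The doubled index exceeds L T / c by at most a constant factor; it is even because Phi contains
   only the even coefficients. *)
set k := Num.truncn _ in k1 k2; exists k.+1.
have -> : (k.+1.*2 = (k.*2.+1).+1)%N by [].
set n := k.*2.+1.
have nE : n.+1%:R = 2 * k.+1%:R :> R by rewrite /n -[k.*2.+2]/(k.+1.*2) -mul2n natrM.
have u1 : L <= c / T * n.+1%:R.
  rewrite mulrC -ler_pdivrMr// (le_trans (ltW k2))// nE ler_peMl//.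
  by rewrite ler1n.
have u2 : c / T * n.+1%:R <= 2 * (L + d).
  have : c / T * k%:R <= L by rewrite mulrC -ler_pdivlMr.
  by rewrite nE -[k.+1]addn1 natrD; move: hd'; set h := c / T; lra.
have u0 : 0 < c / T * n.+1%:R by exact: lt_le_trans u1.
rewrite (le_trans _ (abs_orthopoly_ge_prod b_gt0 b_le n (arg_gt0 T0)))//.
apply: ler_pM => //.
- by rewrite divr_ge0// powR_ge0.
- have -> : 2 * T `^ c / b n = 2 / (c / T * n.+1%:R) `^ c.
    have -> : b n = T `^ c * (c / T * n.+1%:R) `^ c.
      rewrite /b power_coefE// -powRM ?(ltW T0) ?(ltW u0)//; congr (_ `^ _).
      by rewrite mulrA [T * _]mulrC divfK// gt_eqF.
    by field; rewrite !gt_eqF ?powR_gt0.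
  rewrite ler_pM2l// lef_pV2 ?posrE ?powR_gt0//; last first.
    by rewrite mulr_gt0// addr_gt0.
  by apply: ge0_ler_powR; rewrite ?nnegrE ?(ltW u0) ?(ltW c_gt0)// mulr_ge0// addr_ge0 ?(ltW L0) ?(ltW d0).
rewrite prod_rateE// ler_expR (le_trans _ (sum_arsinh_ge c_gt1 n T0))//.
rewrite -[T / c]invf_div [X in _ <= X]mulrC ler_pdivlMr//.
have -> : T * (K - e) * (c / T) = c * K - c * e / 2 - c * e / 2.
  by field; rewrite gt_eqF.
by apply: lerB; [exact: hL|exact: hd].
Qed.

(** Stops just before the turning point, where [int_arcosh] has almost reached its limit. The bound
    n <= T/c limits the loss from the weight w^n in [coef_norm_dominated]. *)
Lemma orthopoly_ge_expR e : 3 / 2 <= c -> 0 < e -> exists T0, 0 < T0 /\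
  forall T, T0 <= T -> exists n, n%:R <= T / c /\
    expR (T * (arcosh_factor c / 2 * K - e)) <= (orthopoly b n).[2 * T `^ c].
Proof.
move=> c32 e0; have e1 : 0 < c * e / 2 by rewrite divr_gt0// mulr_gt0.
have [L /andP[L0 L1] hL] := int_arcosh_near1 c_gt1 e1.
have [d /andP[d0 d1] hd] := int_arcosh_small c_gt1 e1.
pose t := Num.min d ((1 - L) / 2).
have t0 : 0 < t by rewrite lt_min d0 divr_gt0// subr_gt0.
exists (c / t); split; first by rewrite divr_gt0.
move=> T hT; have T0 : 0 < T by apply: lt_le_trans hT; rewrite divr_gt0.
have h0 : 0 < c / T by rewrite divr_gt0.
have ht : c / T <= t by rewrite ler_pdivrMr// mulrC -ler_pdivrMr.
have hd' : c / T <= d by apply: le_trans ht _; rewrite /t ge_min lexx.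
have hL' : c / T <= (1 - L) / 2 by apply: le_trans ht _; rewrite /t ge_min lexx orbT.
have Tc0 : 0 <= T / c by rewrite divr_ge0// ltW.
have /andP[] := truncn_itv Tc0.
(* Taking n = floor(T/c) - 2 keeps u = (c/T)(n+1) below 1 and within 2c/T of 1, hence above L. The
   choice of t rules out floors 0 and 1. *)
case: (Num.truncn _) => [|[|n]] k1 k2.
- exfalso; move: k2; rewrite ltr_pdivrMr// mul1r => k2.
  move: hd'; rewrite ler_pdivrMr// => h.
  have : d * T <= T by rewrite ler_piMl// ltW.
  by move: k2 h; set x := d * T; lra.
- exfalso; move: k2; rewrite ltr_pdivrMr// => k2.
  move: hL'; rewrite ler_pdivrMr// => h.
  have : (1 - L) / 2 * T <= 1 / 2 * T by rewrite ler_pM2r//; lra.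
  by move: k2 h; set x := (1 - L) / 2 * T; lra.
exists n; split.
  by apply: le_trans k1; rewrite ler_nat leqW.
have n1 : c / T * n.+1%:R < 1.
  have : n.+2%:R * c <= T by rewrite -ler_pdivlMr.
  rewrite mulrAC ltr_pdivrMr// mul1r; apply: lt_le_trans.
  by rewrite mulrC ltr_pM2r// ltr_nat.
have n2 : L <= c / T * n.+1%:R.
  have : 1 < c / T * n.+3%:R.
    by rewrite mulrAC ltr_pdivlMr// mul1r mulrC -ltr_pdivrMr.
  have -> : n.+3%:R = n.+1%:R + 2 :> R by rewrite -natrD addn2.
  rewrite mulrDr.
  by move: hL'; set h := c / T; lra.
have hb j : (j < n)%N -> 2 * b j <= 2 * T `^ c.
  move=> jn; rewrite ler_pM2l// /b power_coefE//.
  apply: ge0_ler_powR; rewrite ?nnegrE ?(ltW T0) ?mulr_ge0 ?(ltW c_gt0)//.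
  move: n1; rewrite mulrAC ltr_pdivrMr// mul1r => /ltW; apply: le_trans.
  by rewrite ler_pM2l// ler_nat ltnW.
rewrite (le_trans _ (orthopoly_ge_prod b_gt0 b_le hb))//.
rewrite prod_rateE// ler_expR (le_trans _ (sum_arcosh_ge c_gt1 c32 T0 n1))//.
rewrite -[T / c]invf_div [X in _ <= X]mulrC ler_pdivlMr//.
have -> : T * (arcosh_factor c / 2 * K - e) * (c / T) =
    c * arcosh_factor c / 2 * K - c * e / 2 - c * e / 2.
  by field; rewrite gt_eqF.
by apply: lerB; [exact: hL|exact: hd].
Qed.

Lemma powR_le_expR e T : 0 < e -> 0 <= T -> T `^ c <= (c / e) `^ c * expR (T * e).
Proof.
move=> e0 T0; have ce : 0 < c / e by rewrite divr_gt0.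
have -> : expR (T * e) = expR (T * e / c) `^ c.
  by rewrite -expRM divfK// gt_eqF.
rewrite -powRM ?expR_ge0 ?(ltW ce)//.
apply: ge0_ler_powR; rewrite ?nnegrE ?(ltW c_gt0)//.
  by apply: mulr_ge0; [exact: ltW|exact: expR_ge0].
rewrite -ler_pdivrMl// invf_div.
apply: le_trans (expR_ge1Dx _); rewrite mulrC mulrA.
by rewrite lerDr.
Qed.

(** Up to an index n0 of order L T / c the uniform bound e^(TK) is enough; past it
    [abs_orthopoly_tail] applies, with a product of rates that is small for L large. *)
Lemma abs_orthopoly_decay e : 0 < e -> exists2 C, 0 < C &
  forall T n, 1 <= T ->
    b n * (abs_orthopoly b n).[2 * T `^ c] ^+ 2 <= C * expR (T * (2 * K + e)).
Proof.
(* Half of e absorbs b_(n0+1) = O(T^c), the other half the fourth powers of the tail rates: 4 (T/c)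
   (e c / 8) = T e / 2. *)
move=> e0; have e1 : 0 < e * c / 8 by rewrite divr_gt0// mulr_gt0.
have e2 : 0 < e / 2 by rewrite divr_gt0.
have [L L0 hL] := int_arsinh_large c_gt1 e1.
pose D := b 1 / b 0 * ((L + 2 * c) `^ c * (c / (e / 2)) `^ c).
have D0 : 0 < D by rewrite !mulr_gt0 ?invr_gt0// ?powR_gt0 ?divr_gt0// addr_gt0// mulr_gt0.
exists D => // T n T1; have T0 : 0 < T by exact: lt_le_trans T1.
have h0 : 0 < c / T by rewrite divr_gt0.
have Lh0 : 0 <= L / (c / T) by rewrite divr_ge0// ltW.
have /andP[k1 k2] := truncn_itv Lh0; set n0 := Num.truncn _ in k1 k2.
have hb : b 1 / b 0 * b n0.+1 <= D * expR (T * (e / 2)).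
  rewrite /D -[X in _ <= X]mulrA ler_pM2l ?divr_gt0// /b power_coefE//.
  rewrite -[X in _ <= X]mulrA; apply: (@le_trans _ _ ((L + 2 * c) `^ c * T `^ c)); last first.
    rewrite ler_wpM2l ?powR_ge0//; apply: powR_le_expR => //; exact: ltW.
  have Lc : 0 <= L + 2 * c by rewrite addr_ge0 ?mulr_ge0 ?(ltW L0) ?(ltW c_gt0).
  rewrite -powRM ?(ltW T0)//.
  apply: ge0_ler_powR; rewrite ?nnegrE ?mulr_ge0 ?(ltW c_gt0) ?(ltW T0)//.
  have : c * n0%:R <= L * T.
    by move: k1; rewrite invf_div mulrA ler_pdivlMr// mulrC.
  have : 2 * c <= 2 * c * T by rewrite ler_peMr// mulr_ge0// ltW.
  by rewrite -[n0.+2]addn2 natrD mulrDr mulrDl; lra.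
have E : expR (T * (2 * K + e)) = expR (T * (e / 2)) * (expR (T * K) ^+ 2 * expR (T * (e / 2))).
  by rewrite -expRM_natl -!expRD; congr expR; rewrite mulr_natl; field.
have q0 k : 0 <= (abs_orthopoly b k).[2 * T `^ c].
  by rewrite horner_abs_orthopoly_ge0// ltW// arg_gt0.
have M0 := expR_ge0 (T * K).
have e1' : 1 <= expR (T * (e / 2)).
  by rewrite -[X in X <= _]expR0 ler_expR; apply: mulr_ge0; exact: ltW.
rewrite E (mulrA D).
have [nn0|n0n] := leqP n n0.
  apply: ler_pM; [exact: ltW|exact: exprn_ge0| |].
    apply: le_trans hb; apply: (@le_trans _ _ (b n0.+1)).
      by rewrite b_homo// leqW.
    by rewrite ler_peMl ?(ltW (b_gt0 _))// ler_pdivlMr// mul1r.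
  apply: (@le_trans _ _ (expR (T * K) ^+ 2)); last by rewrite ler_peMr// exprn_ge0.
  by rewrite ler_pXn2r// ?nnegrE// abs_orthopoly_le_expR.
have := abs_orthopoly_tail b_gt0 b_le b_logconcave (arg_gt0 T0)
  (fun k => abs_orthopoly_le_expR k T0) n0n.
move=> /le_trans; apply; rewrite -mulrA.
apply: ler_pM => //.
- by rewrite mulr_ge0// ?divr_ge0// ltW.
- by rewrite mulr_ge0 ?exprn_ge0// prodr_ge0// => j _; rewrite exprn_even_ge0.
rewrite ler_wpM2l ?exprn_ge0//.
have -> : \prod_(n0.+1 <= j < n) rate 1 (b j) (2 * T `^ c) ^+ 4 =
    expR (4 * \sum_(n0.+1 <= j < n) log_rate c 1 (c / T * j.+1%:R)).
  rewrite mulr_sumr expR_sum; apply: eq_bigr => j _.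
  by rewrite rate_power_coef// -expRM_natl.
rewrite ler_expR.
have : L <= c / T * n0.+1%:R by rewrite mulrC -ler_pdivrMr// ltW.
move=> /hL hI.
have h := sum_arsinh_tail c_gt1 T0 n0n.
apply: (@le_trans _ _ (4 * (T / c * (e * c / 8)))).
  rewrite ler_pM2l// (le_trans h)// ler_pM2l ?divr_gt0//.
  by rewrite -/K; move: hI; rewrite -/K; lra.
by rewrite le_eqVlt; apply/orP; left; apply/eqP; field; rewrite gt_eqF.
Qed.

End Asymptotics.

(** * Upper bounds for P_n on the real axis when c < 3/2 *)

Section RealAxis.
Variable R : realType.
Variable c : R.
Hypothesis c_gt1 : 1 < c.
Implicit Types (s e T L : R) (n m k : nat).

Let c_gt0 : 0 < c. Proof. exact: lt_trans c_gt1. Qed.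

Let b := power_coef c.
Let b_gt0 n : 0 < b n. Proof. exact: power_coef_gt0. Qed.
Let b_le n : b n <= b n.+1. Proof. exact: power_coef_le. Qed.
Let K := prim_oo c.
Let lam := arcosh_factor c.

(** Relative to T^(2c) the increment is O(1/T), so for large T the hypothesis of [orthopoly_le_prod]
    holds with d a fixed fraction of x. *)
Lemma power_coef_sqr_increment T n : c <= T -> c * n.+1%:R <= T ->
  b n.+1 ^+ 2 - b n ^+ 2 <= T `^ (2 * c) * (2 * c * 2 `^ (2 * c - 1) * (c / T)).
Proof.
move=> cT nT; have T0 : 0 < T by exact: lt_le_trans cT.
have h0 : 0 < c / T by rewrite divr_gt0.
have h1 : c / T <= 1 by rewrite ler_pdivrMr// mul1r.
pose v := c / T * n.+1%:R; have v0 : 0 < v by rewrite mulr_gt0.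
have v1 : v <= 1 by rewrite /v mulrAC ler_pdivrMr// mul1r.
have bE k : b k ^+ 2 = T `^ (2 * c) * (c / T * k.+1%:R) `^ (2 * c).
  have u0 : 0 < c / T * k.+1%:R by rewrite mulr_gt0.
  rewrite -powRM ?(ltW T0) ?(ltW u0)// /b power_coefE// -powR_mulrn ?powR_ge0//.
  rewrite -powRrM [c * 2]mulrC; congr (_ `^ _).
  by rewrite mulrA [T * _]mulrC divfK// gt_eqF.
rewrite !bE -mulrBr ler_pM2l ?powR_gt0//.
have -> : c / T * n.+2%:R = v + c / T by rewrite /v -[n.+2%:R]natr1 mulrDr mulr1.
rewrite -/v.
have hE : v + c / T - v = c / T by rewrite addrAC subrr add0r.
rewrite -[X in _ <= _ * X]hE.
apply: (@derive_le_increment _ (fun x => x `^ (2 * c))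
  (fun x => 2 * c * x `^ (2 * c - 1))).
- by rewrite lerDl ltW.
- by move=> x /andP[vx _]; apply: is_derive1_powR; exact: lt_le_trans vx.
- move=> x /andP[vx xv]; rewrite ler_pM2l ?mulr_gt0//.
  have x0 : 0 < x by exact: lt_le_trans vx.
  have c21 : 0 <= 2 * c - 1 by have := c_gt1; lra.
  apply: ge0_ler_powR; rewrite ?nnegrE ?(ltW x0)//.
  by rewrite (le_trans xv)// (_ : 2 = 1 + 1)// lerD.
Qed.

(** Three ranges of n. For n <= T/c the supersolution at x + d = 2 (sT)^c applies; over the next
    (s-1) T/c indices, up to a constant number, each step costs a factor 3; from there on x <=
    s^(-c) 2 b_n, and the energy bound loses only a constant. *)
Lemma orthopoly_le_sigma s : c < 3 / 2 -> 1 < s -> exists T0 C, [/\ 0 < T0, 0 < C &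
  forall T n, T0 <= T -> (orthopoly b n).[2 * T `^ c] ^+ 2 <=
    C * expR (T * (s * lam * K + 2 * ln 3 * (s - 1) / c))].
Proof.
move=> c32 s1; have s0 : 0 < s by exact: lt_trans s1.
have sc1 : 1 < s `^ c.
  have : 1 `^ c < s `^ c; last by rewrite powR1.
  by apply: gt0_ltr_powR; rewrite ?nnegrE ?(ltW s0).
pose r := s `^ c - 1; have r0 : 0 < r by rewrite subr_gt0.
pose A := 2 * c * 2 `^ (2 * c - 1) * c.
have A0 : 0 < A by rewrite !mulr_gt0// powR_gt0.
(* The thresholds give, in order: T/c >= 1, the increment condition b_(k+1)^2 - b_k^2 <= d^2, and
   b_0 <= d. *)
pose T0 := Num.max c (Num.max (A / (4 * r ^+ 2)) ((b 0 / (2 * r)) `^ c^-1)).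
pose q := 1 - (s `^ c) ^- 2.
have q0 : 0 < q by rewrite subr_gt0 invf_lt1 ?exprn_gt0 ?powR_gt0// exprn_egt1.
have q1 : q <= 1 by rewrite gerBl invr_ge0 exprn_ge0// powR_ge0.
(* The factor 4/q is the energy loss; 81 = (3^2)^2 comes from the two extra steps in k = k0 + 2. *)
exists T0, (4 * 81 / q); split.
- by rewrite lt_max c_gt0.
- by rewrite divr_gt0.
move=> T n; rewrite !ge_max => /andP[cT /andP[TA Tb]].
have Tp : 0 < T by exact: lt_le_trans cT.
have Tc : 0 < T `^ c by exact: powR_gt0.
have Tc0 : 0 <= T / c by rewrite divr_ge0// ltW.
set x := 2 * T `^ c; have x0 : 0 < x by rewrite mulr_gt0.
pose d := x * r; have d0 : 0 < d by rewrite mulr_gt0.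
have sT0 : 0 < s * T by rewrite mulr_gt0.
have xd : x + d = 2 * (s * T) `^ c.
  by rewrite /d /r /x powRM ?(ltW s0) ?(ltW Tp)//; ring.
have hb2 k : (2 * b k <= x) = (c * k.+1%:R <= T).
  rewrite ler_pM2l// /b power_coefE//; apply/idP/idP.
    apply: contraTT; rewrite -!ltNge => h.
    by apply: gt0_ltr_powR => //; rewrite nnegrE ?mulr_ge0 ?(ltW Tp) ?(ltW c_gt0).
  by apply: ge0_ler_powR; rewrite ?nnegrE ?mulr_ge0 ?(ltW Tp) ?(ltW c_gt0).
have hb0 : b 0 <= d.
  have : b 0 / (2 * r) <= T `^ c.
    have -> : b 0 / (2 * r) = ((b 0 / (2 * r)) `^ c^-1) `^ c.
      rewrite -powRrM mulVf ?gt_eqF// powRr1//.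
      by apply: divr_ge0; [exact: ltW|rewrite mulr_ge0// ltW].
    by apply: ge0_ler_powR; rewrite ?nnegrE ?powR_ge0 ?(ltW Tp) ?(ltW c_gt0).
  by rewrite ler_pdivrMr ?mulr_gt0// /d /x; lra.
have hd k : 2 * b k <= x -> b k.+1 ^+ 2 - b k ^+ 2 <= d ^+ 2.
  rewrite hb2 => h; rewrite (le_trans (power_coef_sqr_increment cT h))//.
  have -> : T `^ (2 * c) = (T `^ c) ^+ 2.
    by rewrite [2 * c]mulrC powRrM powR_mulrn// powR_ge0.
  have -> : d ^+ 2 = (T `^ c) ^+ 2 * (4 * r ^+ 2) by rewrite /d /x; ring.
  rewrite ler_pM2l ?exprn_gt0// mulrA ler_pdivrMr// [X in _ <= X]mulrC -ler_pdivrMr//.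
  by rewrite mulr_gt0// exprn_gt0.
have /andP[] := truncn_itv Tc0.
case E : (Num.truncn _) => [|m] k1 k2.
  by exfalso; move: k2; rewrite ltr_pdivrMr// mul1r ltNge cT.
have hm j : (j < m.+1)%N -> 2 * b j <= x.
  move=> jm; rewrite hb2 mulrC -ler_pdivlMr//; apply: le_trans k1.
  by rewrite ler_nat.
pose M := expR (s * T * (lam / 2 * K)).
have M0 : 0 < M by exact: expR_gt0.
have small j : (j <= m.+1)%N -> `|(orthopoly b j).[x]| <= M.
  move=> jm; have hj i : (i < j)%N -> 2 * b i <= x by move=> ij; apply: hm; exact: leq_trans jm.
  have /andP[h1 h2] := orthopoly_le_prod b_gt0 b_le (ltW d0) hb0 hd hj.
  rewrite ger0_norm// (le_trans h2)// xd prod_rateE// ler_expR.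
  apply: sum_arcosh_le => //; first exact: ltW.
  rewrite mulrAC ltr_pdivrMr// mul1r (@le_lt_trans _ _ T)//; last by rewrite ltr_pMl.
  by rewrite mulrC -ler_pdivlMr// (le_trans _ k1)// ler_nat.
have sT1 : 0 <= (s - 1) * T / c by rewrite divr_ge0 ?mulr_ge0 ?subr_ge0 ?(ltW s1) ?(ltW Tp)// ltW.
have /andP[] := truncn_itv sT1; set k0 := Num.truncn _ => l1 l2.
(* Then m + k + 1 = (m + 2) + (k0 + 1) is at least T/c + (s-1) T/c = sT/c, that is, b_(m+k) >=
   (sT)^c. *)
pose k := k0.+2.
have xm : x <= 2 * b m.+1.
  by rewrite leNgt; apply/negP => /ltW; rewrite hb2 leNgt mulrC -ltr_pdivrMr// k2.
pose W := 3 ^+ k * M.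
have W0 : 0 <= W by rewrite mulr_ge0 ?exprn_ge0// ltW.
have crude i : (i <= k)%N -> Num.max `|(orthopoly b (m + i)).[x]| `|(orthopoly b (m + i).+1).[x]| <= W.
  move=> ik; rewrite (le_trans (orthopoly_crude b_gt0 b_le i (ltW x0) xm))//.
  apply: ler_pM.
  - by rewrite exprn_ge0.
  - by rewrite le_max normr_ge0.
  - by rewrite ler_weXn2l// ler1n.
  - by rewrite ge_max !small.
have W2 : W ^+ 2 <= 81 * expR (T * (s * lam * K + 2 * ln 3 * (s - 1) / c)).
  have -> : expR (T * (s * lam * K + 2 * ln 3 * (s - 1) / c)) =
      (expR ((s - 1) * T / c * ln 3) * M) ^+ 2.
    rewrite /M -expRD -expRM_natl; congr expR.
    by field; rewrite gt_eqF.
  have -> : 81 = 9 ^+ 2 :> R by rewrite expr2; ring.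
  have hW : W <= 9 * (expR ((s - 1) * T / c * ln 3) * M).
    have e9 : 9 = 3 ^+ 2 :> R by rewrite expr2; ring.
    rewrite /W mulrA ler_pM2r// /k -(addn2 k0) exprD mulrC e9 ler_pM2l ?exprn_gt0//.
    rewrite -[X in X ^+ _](@lnK R 3) ?posrE// -expRM_natl ler_expR.
    by rewrite ler_wpM2r// ln_ge0// ler1n.
  by rewrite -exprMn ler_pXn2r// nnegrE (le_trans W0).
have Wq : W ^+ 2 <= 4 * W ^+ 2 / q.
  rewrite ler_pdivlMr//; have := sqr_ge0 W; move: (W ^+ 2) => w w0.
  by rewrite mulrC; nra.
suff : (orthopoly b n).[x] ^+ 2 <= 4 * W ^+ 2 / q.
  have E3 (y : R) : 4 * 81 / q * y = 4 * (81 * y) / q by ring.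
  by rewrite E3 => h; rewrite (le_trans h)// ler_pM2r ?invr_gt0// ler_pM2l.
have sqW j : `|(orthopoly b j).[x]| <= W -> (orthopoly b j).[x] ^+ 2 <= 4 * W ^+ 2 / q.
  move=> h; apply: le_trans Wq; rewrite -[X in X <= _]real_normK ?num_real//.
  by rewrite ler_pXn2r ?nnegrE.
have [nm|mn] := leqP n m.
  apply: sqW; rewrite (le_trans (small n (leqW nm)))// ler_peMl ?(ltW M0)//.
  by rewrite exprn_ege1// ler1n.
have [nk|kn] := leqP n (m + k).
  apply: sqW; have := crude (n - m)%N; rewrite subnKC ?(ltnW mn)// leq_subLR => /(_ nk).
  by apply: le_trans; rewrite le_max lexx.
have bk : s `^ c * T `^ c <= b (m + k).
  rewrite -powRM ?(ltW s0) ?(ltW Tp)// /b power_coefE//.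
  apply: ge0_ler_powR; rewrite ?nnegrE ?mulr_ge0 ?(ltW c_gt0) ?(ltW s0) ?(ltW Tp)//.
  rewrite -ler_pdivrMl// mulrC.
  have -> : (m + k).+1%:R = m.+2%:R + k0.+1%:R :> R by rewrite -natrD /k addSn addSn !addnS.
  have -> : s * T / c = T / c + (s - 1) * T / c by field; rewrite gt_eqF.
  by rewrite lerD// ltW.
have osc : x < 2 * b (m + k).
  rewrite ltr_pM2l// (lt_le_trans _ bk)// ltr_pMl//.
have := orthopoly_oscillatory b_gt0 b_le (ltW x0) osc (ltnW kn).
set B := b (m + k) in bk osc *; have B0 : 0 < B by exact: b_gt0.
have hE : energy b x (m + k) <= 4 * B ^+ 2 * W ^+ 2.
  have := crude k (leqnn k); rewrite ge_max => /andP[p0 p1].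
  rewrite /energy -/B; move: p0 p1.
  set P0 := (orthopoly b (m + k)).[x]; set P1 := (orthopoly b (m + k).+1).[x] => p0 p1.
  have P02 : P0 ^+ 2 <= W ^+ 2 by rewrite -[X in X <= _]real_normK ?num_real// ler_pXn2r ?nnegrE.
  have P12 : P1 ^+ 2 <= W ^+ 2 by rewrite -[X in X <= _]real_normK ?num_real// ler_pXn2r ?nnegrE.
  have P01 : - (P1 * P0) <= W ^+ 2.
    by rewrite (le_trans (ler_norm _))// normrN normrM expr2 ler_pM.
  have h1 : x * B <= 2 * B ^+ 2 by rewrite expr2 mulrA ler_pM2r// ltW.
  have h2 : x * B * - (P1 * P0) <= x * B * W ^+ 2 by rewrite ler_pM2l// mulr_gt0.
  have h3 : x * B * W ^+ 2 <= 2 * B ^+ 2 * W ^+ 2 by rewrite ler_wpM2r// sqr_ge0.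
  have h4 : B ^+ 2 * P1 ^+ 2 <= B ^+ 2 * W ^+ 2 by rewrite ler_wpM2l// sqr_ge0.
  have h5 : B ^+ 2 * P0 ^+ 2 <= B ^+ 2 * W ^+ 2 by rewrite ler_wpM2l// sqr_ge0.
  have -> : B ^+ 2 * (P1 ^+ 2 + P0 ^+ 2) - x * B * P1 * P0 =
     B ^+ 2 * P1 ^+ 2 + B ^+ 2 * P0 ^+ 2 + x * B * - (P1 * P0) by ring.
  have -> : 4 * B ^+ 2 * W ^+ 2 = B ^+ 2 * W ^+ 2 + B ^+ 2 * W ^+ 2 + 2 * B ^+ 2 * W ^+ 2 by ring.
  by rewrite lerD// ?lerD// (le_trans h2).
move=> /le_trans /(_ hE) h.
have Bq : q * B ^+ 2 <= B ^+ 2 - x ^+ 2 / 4.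
  rewrite /q mulrBl mul1r lerD2l lerN2 [X in _ <= X]mulrC ler_pdivlMr ?exprn_gt0 ?powR_gt0//.
  have -> : x ^+ 2 / 4 * (s `^ c) ^+ 2 = (s `^ c * T `^ c) ^+ 2 by rewrite /x; field.
  by rewrite ler_pXn2r ?nnegrE ?mulr_ge0 ?powR_ge0 ?(ltW B0).
rewrite ler_pdivlMr// mulrC -(ler_pM2r (exprn_gt0 2 B0)) mulrAC.
rewrite (le_trans (ler_wpM2r (sqr_ge0 _) Bq))// (le_trans h)//.
by rewrite mulrAC.
Qed.

Lemma orthopoly_le_expR : c < 3 / 2 -> exists e T0 C, [/\ 0 < e, 0 < T0, 0 < C &
  forall T n, T0 <= T ->
    (orthopoly b n).[2 * T `^ c] ^+ 2 <= C * expR (T * (K - e))].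
Proof.
move=> c32; have l1 := arcosh_factor_lt1 c_gt1 c32; rewrite -/lam in l1.
have l0 : 0 < lam by exact: arcosh_factor_gt0.
have K0 : 0 < K by exact: prim_oo_gt0.
have ln3 : 0 <= ln 3 :> R by rewrite ln_ge0// ler1n.
(* D is the coefficient of s - 1 in the exponent of [orthopoly_le_sigma]; with s = 1 + g/D that
   exponent is lambda K + g = K - g. *)
pose D := lam * K + 2 * ln 3 / c.
have D0 : 0 < D by rewrite ltr_pwDl ?mulr_gt0// divr_ge0 ?mulr_ge0// ltW.
pose g := (1 - lam) * K / 2.
have g0 : 0 < g by rewrite divr_gt0// mulr_gt0// subr_gt0.
have s1 : 1 < 1 + g / D by rewrite ltrDl divr_gt0.
have [T0 [C [T0p Cp H]]] := orthopoly_le_sigma c32 s1.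
exists g, T0, C; split=> // T n hT; rewrite (le_trans (H T n hT))//.
rewrite ler_pM2l// ler_expR ler_pM2l ?(lt_le_trans T0p hT)//.
rewrite le_eqVlt; apply/orP; left; apply/eqP.
transitivity (lam * K + g / D * (lam * K + 2 * ln 3 / c)).
  by move: (g / D) => t; field; rewrite gt_eqF.
rewrite -/D.
by rewrite divfK ?gt_eqF// /g; field.
Qed.

End RealAxis.

(** * The numbers c_k and property (cs) *)

Section CoefNorm.
Variable R : realType.
Variable c : R.
Hypothesis c_gt1 : 1 < c.
Implicit Types (s e T x : R) (n m k : nat).

Let c_gt0 : 0 < c. Proof. exact: lt_trans c_gt1. Qed.

Let b := power_coef c.
Let b_gt0 n : 0 < b n. Proof. exact: power_coef_gt0. Qed.
Let b_le n : b n <= b n.+1. Proof. exact: power_coef_le. Qed.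
Let K := prim_oo c.
Let lam := arcosh_factor c.

Lemma sum_powRN_le n :
  \sum_(j < n.+1) j.+1%:R `^ (- c) <= 1 + (1 - n.+1%:R `^ (1 - c)) / (c - 1).
Proof.
have c1 : 0 < c - 1 by rewrite subr_gt0.
elim: n => [|n IH]; first by rewrite big_ord1 !powR1 subrr mul0r addr0.
have -> : \sum_(j < n.+2) j.+1%:R `^ (- c) =
  \sum_(j < n.+1) j.+1%:R `^ (- c) + n.+2%:R `^ (- c) by rewrite big_ord_recr.
have : n.+2%:R `^ (1 - c) - n.+1%:R `^ (1 - c) <=
    ((1 - c) * n.+2%:R `^ (- c)) * (n.+2%:R - n.+1%:R).
  apply: (@derive_le_increment _ (fun x => x `^ (1 - c))
    (fun x => (1 - c) * x `^ (1 - c - 1))).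
  - by rewrite ler_nat.
  - move=> x /andP[nx _]; apply: is_derive1_powR; exact: lt_le_trans nx.
  - move=> x /andP[nx xn]; have x0 : 0 < x by exact: lt_le_trans nx.
    rewrite addrAC subrr add0r ler_nM2l ?subr_lt0// !powRN.
    rewrite lef_pV2 ?posrE ?powR_gt0//.
    by apply: ge0_ler_powR; rewrite ?nnegrE ?(ltW c_gt0) ?(ltW x0).
have -> : n.+2%:R - n.+1%:R = 1 :> R by rewrite -natrB// subSnn.
rewrite mulr1 => h.
set A := n.+1%:R `^ (1 - c) in IH h *; set B := n.+2%:R `^ (1 - c) in h *.
set p := n.+2%:R `^ (- c) in h *.
have h' : p <= (A - B) / (c - 1).
  have -> : A - B = - (B - A) by ring.
  have -> : p = - ((1 - c) * p) / (c - 1) by field; rewrite gt_eqF.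
  by rewrite ler_pM2r ?invr_gt0// lerN2.
apply: (le_trans (lerD IH h')).
by rewrite le_eqVlt; apply/orP; left; apply/eqP; ring.
Qed.

Lemma sum_inv_power_coef_le n : \sum_(j < n) (b j)^-1 <= 1 + (c - 1)^-1.
Proof.
have c1 : 0 < c - 1 by rewrite subr_gt0.
case: n => [|n]; first by rewrite big_ord0 addr_ge0// invr_ge0 ltW.
apply: (@le_trans _ _ (\sum_(j < n.+1) j.+1%:R `^ (- c))).
  apply: ler_sum => j _; rewrite powRN lef_pV2 ?posrE ?powR_gt0//.
  rewrite /b power_coefE//; apply: ge0_ler_powR; rewrite ?nnegrE ?mulr_ge0 ?(ltW c_gt0)//.
  by rewrite ler_peMl// ltW.
by rewrite (le_trans (sum_powRN_le n))// lerD2l ler_pdivrMr// mulVf ?gt_eqF// gerBl.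
Qed.

Lemma sum_sqr_abs_orthopoly_le e : 0 < e -> exists2 C, 0 < C & forall T n, 1 <= T ->
  \sum_(j < n) (abs_orthopoly b j).[2 * T `^ c] ^+ 2 <= C * expR (T * (2 * K + e)).
Proof.
move=> e0; have [C C0 hC] := abs_orthopoly_decay c_gt1 e0.
have c1 : 0 < c - 1 by rewrite subr_gt0.
have B0 : 0 < 1 + (c - 1)^-1 by rewrite addr_gt0// invr_gt0.
exists (C * (1 + (c - 1)^-1)); first by rewrite mulr_gt0.
move=> T n T1; set E := expR _.
apply: (@le_trans _ _ (\sum_(j < n) C * E * (b j)^-1)).
  by apply: ler_sum => j _; rewrite ler_pdivlMr// mulrC hC.
rewrite -mulr_sumr [X in _ <= X]mulrAC ler_wpM2l ?sum_inv_power_coef_le//.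
by rewrite mulr_ge0 ?expR_ge0// ltW.
Qed.

Let csum k n := \sum_(k <= j < n) ((orthopoly b j)`_k) ^+ 2.

(** A Cauchy estimate: for nonnegative coefficients each term is at most the value. So c_k y^k is
    controlled by the l^2 norm of the sequence (q_j(y)), with y free to choose. *)
Let csum_le y k n : 0 <= y ->
  csum k n * (y ^+ k) ^+ 2 <= \sum_(j < n) (abs_orthopoly b j).[y] ^+ 2.
Proof.
move=> y0; rewrite -(big_mkord xpredT (fun j => (abs_orthopoly b j).[y] ^+ 2)).
rewrite /csum mulr_suml (big_nat_widenl _ 0%N)// big_mkcond; apply: ler_sum => j _.
case: ifP => _; last exact: sqr_ge0.
rewrite sqr_coef_orthopoly// -exprMn ler_pXn2r ?nnegrE//.
- exact: coef_le_horner_abs_orthopoly.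
- by rewrite mulr_ge0 ?exprn_ge0// coef_abs_orthopoly_ge0.
- exact: horner_abs_orthopoly_ge0.
Qed.

Let csum_homo k : nondecreasing_seq (csum k).
Proof.
move=> m n mn; rewrite /csum; have [km|mk] := leqP k m.
  by rewrite (big_cat_nat km mn)/= lerDl sumr_ge0// => i _; exact: sqr_ge0.
by rewrite (big_geq (ltnW mk)) sumr_ge0// => i _; exact: sqr_ge0.
Qed.

(** Makes the limit in [coef_norm] a genuine sum; the case T = 1 of the square-sum bound
    suffices. *)
Let csum_cvg k : cvgn (csum k).
Proof.
apply: nondecreasing_is_cvgn; first exact: csum_homo.
have [C C0 hC] := sum_sqr_abs_orthopoly_le ltr01.
have y0 : 0 < 2 * 1 `^ c :> R by rewrite powR1 mulr1.
exists (C * expR (1 * (2 * K + 1)) / ((2 * 1 `^ c) ^+ k) ^+ 2) => _ [n _ <-].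
rewrite ler_pdivlMr ?exprn_gt0// (le_trans (csum_le _ _ (ltW y0)))//.
exact: hC.
Qed.

Lemma coef_norm_ge0 k : 0 <= coef_norm b k. Proof. exact: sqrtr_ge0. Qed.

Lemma coef_abs_orthopoly_le_norm n k : (abs_orthopoly b n)`_k <= coef_norm b k.
Proof.
have [kn|nk] := leqP k n; last first.
  by rewrite nth_default ?coef_norm_ge0// (leq_trans (size_abs_orthopoly _ _)).
rewrite -[X in X <= _]ger0_norm ?coef_abs_orthopoly_ge0// -sqrtr_sqr.
rewrite ler_wsqrtr// -sqr_coef_orthopoly//.
apply: le_trans (nondecreasing_cvgn_le (@csum_homo k) (@csum_cvg k) n.+1).
rewrite /csum big_nat_recr//= lerDr sumr_ge0// => i _; exact: sqr_ge0.
Qed.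

Lemma coef_norm_le e : 0 < e -> exists2 C, 0 < C & forall T k, 1 <= T ->
  coef_norm b k * (2 * T `^ c) ^+ k <= C * expR (T * (K + e)).
Proof.
move=> e0; have e2 : 0 < 2 * e by rewrite mulr_gt0.
have [C C0 hC] := sum_sqr_abs_orthopoly_le e2.
exists (Num.sqrt C); first by rewrite sqrtr_gt0.
move=> T k T1; have T0 : 0 < T by exact: lt_le_trans T1.
have y0 : 0 < 2 * T `^ c by rewrite mulr_gt0// powR_gt0.
set y := 2 * T `^ c in y0 *.
have yk : 0 < (y ^+ k) ^+ 2 by rewrite !exprn_gt0.
have h : limn (csum k) <= C * expR (T * (2 * K + 2 * e)) / (y ^+ k) ^+ 2.
  apply: limr_le; first exact: csum_cvg.
  apply: nearW => n; rewrite ler_pdivlMr// (le_trans (csum_le _ _ (ltW y0)))//.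
  exact: hC.
have hE : C * expR (T * (2 * K + 2 * e)) = C * expR (T * (K + e)) ^+ 2.
  by rewrite -expRM_natl; congr (_ * expR _); ring.
rewrite hE in h.
rewrite /coef_norm -/(csum k).
rewrite -ler_pdivlMr ?exprn_gt0// (le_trans (ler_wsqrtr h))//.
rewrite sqrtrM ?mulr_ge0 ?(ltW C0) ?sqr_ge0// sqrtrM ?(ltW C0)// sqrtr_sqr.
rewrite ger0_norm ?expR_ge0// sqrtrV ?sqr_ge0// sqrtr_sqr ger0_norm//.
by rewrite exprn_ge0// ltW.
Qed.

Lemma exists_powR_arg x : 0 < x -> exists2 T, 0 < T & x = 2 * T `^ c.
Proof.
move=> x0; exists ((x / 2) `^ c^-1); first by rewrite powR_gt0// divr_gt0.
rewrite -powRrM mulVf ?gt_eqF// powRr1; first by field.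
by rewrite divr_ge0// ltW.
Qed.

Lemma arg_ge T x : 0 <= T -> 2 * T `^ c <= x -> exists2 S, T <= S & x = 2 * S `^ c.
Proof.
move=> T0; rewrite le_eqVlt => /predU1P[<-|h]; first by exists T.
have x0 : 0 < x by rewrite (le_lt_trans _ h)// mulr_ge0// powR_ge0.
have [S S0 xE] := exists_powR_arg x0; exists S => //.
rewrite leNgt; apply/negP => ST; move: h; rewrite xE ltNge => /negP; apply.
by rewrite ler_pM2l//; apply: ge0_ler_powR; rewrite ?nnegrE ?(ltW c_gt0) ?(ltW S0) ?(ltW ST).
Qed.

Lemma orthopoly_abs_sqr n x : (orthopoly b n).[`|x|] ^+ 2 = (orthopoly b n).[x] ^+ 2.
Proof.
have [x0|x0] := leP 0 x; first by rewrite ger0_norm.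
by rewrite ltr0_norm// horner_orthopolyN// exprMn sqrr_sign mul1r.
Qed.

(** Estimating c_2k at the larger argument 2 (sT)^c gains the geometric factor s^(-2ck), summable in
    k, at a small exponential cost. The square of the large P_n from [orthopoly_ge_expR] pays for
    it, as lambda > 1. *)
Lemma coef_norm_dominated : 3 / 2 < c -> exists C q w,
  [/\ 0 < C, 0 < q < 1, 0 < w < 1 & forall k x, exists n,
    coef_norm b k.*2 * x ^+ k.*2 <= C * q ^+ k * (w ^+ n * (orthopoly b n).[x] ^+ 2)].
Proof.
move=> c32; have l1 : 1 < lam by exact: arcosh_factor_gt1.
have K0 : 0 < K by exact: prim_oo_gt0.
(* Budget for the gap g between lambda K and K: 2e = g/4 for the lower bound of P_n^2, g/4 for
   passing from T to sT, and n dl <= T g/4 for the weight w^n. *)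
pose g := (lam - 1) * K; have g0 : 0 < g by rewrite mulr_gt0// subr_gt0.
pose e := g / 8; have e0 : 0 < e by rewrite divr_gt0.
pose dl := c * g / 4; have dl0 : 0 < dl by rewrite divr_gt0// mulr_gt0.
have Ke0 : 0 < K + e by rewrite addr_gt0.
pose s := 1 + g / 8 / (K + e).
have s1 : 1 < s by rewrite ltrDl !divr_gt0.
have s0 : 0 < s by exact: lt_trans s1.
have sE : s * (K + e) = K + g / 4.
  by rewrite /s mulrDl mul1r divfK ?gt_eqF// /e; field.
have [C C0 hC] := coef_norm_le e0.
have [T1 [T1p hT]] := orthopoly_ge_expR c_gt1 (ltW c32) e0.
pose T0 := Num.max 1 T1.
have T01 : 1 <= T0 by rewrite le_max lexx.
have T0T : T1 <= T0 by rewrite le_max lexx orbT.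
have T0p : 0 < T0 by exact: lt_le_trans T01.
pose r := s `^ c.
have r1 : 1 < r.
  have : 1 `^ c < s `^ c; last by rewrite powR1.
  by apply: gt0_ltr_powR; rewrite ?nnegrE ?(ltW s0).
have r0 : 0 < r by exact: lt_trans r1.
have key T k : T0 <= T -> coef_norm b k.*2 * (2 * T `^ c) ^+ k.*2 <=
    C * (r ^- 2) ^+ k * expR (T * (K + g / 4)).
  move=> hTT; have Tp : 0 < T by exact: lt_le_trans hTT.
  have sT1 : 1 <= s * T.
    rewrite (le_trans T01)// (le_trans hTT)// ler_peMl// ?ltW//.
  have := hC _ k.*2 sT1; rewrite powRM ?(ltW s0) ?(ltW Tp)//.
  have -> : s * T * (K + e) = T * (K + g / 4) by rewrite mulrAC sE mulrC.
  rewrite -/r.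
  have -> : (2 * (r * T `^ c)) ^+ k.*2 = (2 * T `^ c) ^+ k.*2 * (r ^+ 2) ^+ k.
    by rewrite mulrCA exprMn mulrC -exprM -mul2n.
  rewrite mulrA -ler_pdivlMr ?exprn_gt0// => /le_trans; apply.
  by rewrite exprVn mulrAC.
exists (C * expR (T0 * (K + g / 4))), (r ^- 2), (expR (- dl)); split.
- by rewrite mulr_gt0// expR_gt0.
- by rewrite invr_gt0 exprn_gt0//= invf_lt1 ?exprn_gt0// exprn_egt1.
- by rewrite expR_gt0 -[X in _ < X]expR0 ltr_expR oppr_lt0.
move=> k x; have -> : x ^+ k.*2 = `|x| ^+ k.*2.
  by rewrite -mul2n !exprM real_normK// num_real.
have q0 : 0 <= (r ^- 2) ^+ k by rewrite exprn_ge0// invr_ge0 exprn_ge0// ltW.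
(* On the bounded range P_0 = 1 dominates; the constant absorbs the bound at T0. *)
have [xs|xl] := leP `|x| (2 * T0 `^ c).
  exists 0%N; rewrite expr0 horner_orthopoly0 expr1n !mulr1.
  apply: le_trans (le_trans (key T0 k (lexx _)) _); last by rewrite mulrAC.
  by rewrite ler_wpM2l ?coef_norm_ge0// lerXn2r// nnegrE// (le_trans _ xs).
have [T hTT xE] := arg_ge (ltW T0p) (ltW xl).
have Tp : 0 < T by exact: lt_le_trans hTT.
have [n [nT hn]] := hT T (le_trans T0T hTT).
exists n; rewrite -orthopoly_abs_sqr xE (le_trans (key T k hTT))//.
rewrite [C * expR _ * _]mulrAC -[X in _ <= X]mulrA ler_wpM2l ?mulr_ge0 ?(ltW C0)//.
apply: (@le_trans _ _ (expR (T * (lam / 2 * K - e)) ^+ 2 * expR (- dl) ^+ n)); last first.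
  rewrite -[X in X <= _]mul1r; apply: ler_pM; first exact: ler01.
  - by rewrite mulr_ge0 ?sqr_ge0// exprn_ge0// expR_ge0.
  - rewrite -[X in X <= _]expR0 ler_expR mulr_ge0 ?(ltW T0p)//.
    by rewrite addr_ge0 ?(ltW K0)// divr_ge0// ltW.
  rewrite mulrC ler_wpM2l ?exprn_ge0 ?expR_ge0//.
  by rewrite ler_pXn2r ?nnegrE ?expR_ge0// (le_trans (expR_ge0 _) hn).
rewrite -!expRM_natl -expRD ler_expR.
have nd : n%:R * dl <= T * (g / 4).
  rewrite (le_trans (ler_wpM2r (ltW dl0) nT))// /dl le_eqVlt; apply/orP; left; apply/eqP.
  by field; rewrite gt_eqF.
have -> : 2%:R * (T * (lam / 2 * K - e)) + n%:R * - dl =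
    T * (K + g / 4) + T * (g / 4) + (T * (g / 4) - n%:R * dl).
  by rewrite /e /g; field.
rewrite -addrA lerDl addr_ge0 ?subr_ge0//.
by rewrite mulr_ge0 ?(ltW Tp)// divr_ge0// ltW.
Qed.

(** For large |x|, P_n^2 is at most a multiple of e^(T(K-e)), hence of some q_2m(|x|), whose
    coefficients are at most the c_2k. On the bounded range the term c_0 >= 1 is enough. *)
Lemma orthopoly_dominated : c < 3 / 2 -> exists2 C, 0 < C & forall n x, exists m,
  (orthopoly b n).[x] ^+ 2 <= C * \sum_(k < m.+1) coef_norm b k.*2 * x ^+ k.*2.
Proof.
move=> c32; have [e [T1 [C1 [e0 T1p C1p h1]]]] := orthopoly_le_expR c_gt1 c32.
have [T2 [C2 [T2p C2p h2]]] := abs_orthopoly_ge_expR c_gt1 e0.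
pose T0 := Num.max T1 T2.
have T01 : T1 <= T0 by rewrite le_max lexx.
have T02 : T2 <= T0 by rewrite le_max lexx orbT.
have T0p : 0 < T0 by exact: lt_le_trans T01.
pose A := C1 / C2; pose B := expR (T0 * K) ^+ 2.
have A0 : 0 < A by rewrite divr_gt0.
have B0 : 0 < B by rewrite exprn_gt0// expR_gt0.
exists (A + B); first by rewrite addr_gt0.
move=> n x.
have xE k : x ^+ k.*2 = `|x| ^+ k.*2.
  by rewrite -mul2n !exprM real_normK// num_real.
have S0 m : 0 <= \sum_(k < m.+1) coef_norm b k.*2 * x ^+ k.*2.
  by rewrite sumr_ge0// => k _; rewrite mulr_ge0 ?coef_norm_ge0// xE exprn_ge0.
have [xs|xl] := leP `|x| (2 * T0 `^ c).
  exists 0%N; rewrite big_ord1 mulr1.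
  have n1 : 1 <= coef_norm b 0.
    by apply: le_trans (coef_abs_orthopoly_le_norm 0 0); rewrite coefC.
  apply: (@le_trans _ _ B); last first.
    rewrite -[X in X <= _]mulr1; apply: ler_pM => //; first exact: ltW.
    by rewrite lerDr ltW.
  rewrite -[X in X <= _]real_normK ?num_real// ler_pXn2r ?nnegrE ?expR_ge0//.
  rewrite (le_trans (norm_orthopoly_le b_gt0 n x))//.
  rewrite (le_trans (ler_horner_abs_orthopoly b_gt0 n _ xs))//.
  exact: abs_orthopoly_le_expR.
have [T hTT Tx] := arg_ge (ltW T0p) (ltW xl).
have [m hm] := h2 T (le_trans T02 hTT).
exists m; rewrite -orthopoly_abs_sqr Tx (le_trans (h1 T n (le_trans T01 hTT)))//.
apply: (@le_trans _ _ (A * (abs_orthopoly b m.*2).[2 * T `^ c])).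
  by rewrite /A -mulrA ler_pM2l// [X in _ <= X]mulrC ler_pdivlMr// [X in X <= _]mulrC.
rewrite -Tx horner_abs_orthopoly_even//.
apply: (@le_trans _ _ (A * \sum_(k < m.+1) coef_norm b k.*2 * x ^+ k.*2)); last first.
  by rewrite ler_wpM2r// lerDl ltW.
rewrite ler_pM2l//; apply: ler_sum => k _; rewrite xE ler_wpM2r ?exprn_ge0//.
exact: coef_abs_orthopoly_le_norm.
Qed.

(** For fixed x, [abs_orthopoly_decay] bounds b_n P_n(x)^2, and b_n >= n + 1. Enlarging |x| to |x| +
    2 ensures T >= 1. *)
Lemma orthopoly_cvg0 x : (fun n => (orthopoly b n).[x] ^+ 2) @ \oo --> (0 : R).
Proof.
have [C C0 hC] := abs_orthopoly_decay c_gt1 ltr01.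
have hx : 2 * 1 `^ c <= `|x| + 2 by rewrite powR1 mulr1 lerDr.
have [T T1 Tx] := arg_ge ler01 hx.
pose D := C * expR (T * (2 * K + 1)).
have D0 : 0 <= D by rewrite mulr_ge0 ?(ltW C0)// expR_ge0.
have bn n : n.+1%:R <= b n.
  rewrite /b power_coefE// (@le_trans _ _ (c * n.+1%:R))//.
    by rewrite ler_peMl// ltW.
  by apply: le1r_powR; [rewrite mulr_ege1 ?ler1n// ltW|exact: ltW].
apply: (@squeeze_cvgr _ _ _ _ (cst 0) (D \*: (@harmonic R))).
- apply: nearW => n; rewrite sqr_ge0 /= /GRing.scale /=.
  rewrite ler_pdivlMr// (@le_trans _ _ (b n * (abs_orthopoly b n).[2 * T `^ c] ^+ 2)) ?hC//.
  rewrite mulrC; apply: ler_pM; rewrite ?sqr_ge0//.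
  rewrite -[X in X <= _]real_normK ?num_real// ler_pXn2r ?nnegrE//.
    rewrite -Tx (le_trans (norm_orthopoly_le b_gt0 n x))//.
    by rewrite ler_horner_abs_orthopoly// lerDl.
  by rewrite horner_abs_orthopoly_ge0// -Tx addr_ge0.
- exact: cvg_cst.
- rewrite -(scaler0 _ D); apply: cvgZr; exact: cvg_harmonic.
Qed.

End CoefNorm.

(** * Integration against a solution of the moment problem *)

Section MomentProblem.
Variable R : realType.
Variable b : nat -> R.
Variable mu : probability (measurableTypeR R) R.
Hypothesis smp : solves_moment_problem b mu.

Lemma measurable_horner (p : {poly R}) : measurable_fun [set: measurableTypeR R] (horner p).
Proof.
apply: (@continuous_measurable_fun R (horner p)).
exact: continuous_horner.
Qed.

Lemma integral_moment n :
  (\int[mu]_x (x ^+ n)%:E = (moment mu n)%:E)%E.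
Proof. by rewrite /moment /Rintegral fineK// integrable_fin_num// (smp_moments smp). Qed.

Lemma moment_even_ge0 n : 0 <= moment mu n.*2.
Proof. by apply: Rintegral_ge0 => x _; rewrite -mul2n exprM exprn_ge0// sqr_ge0. Qed.

Lemma integral_orthopoly_sqr n :
  (\int[mu]_x ((orthopoly b n).[x] ^+ 2)%:E = 1)%E.
Proof.
have := smp_orthonormal smp n n; rewrite eqxx /Rintegral.
set I := (X in fine X); have -> : I = (\int[mu]_x ((orthopoly b n).[x] ^+ 2)%:E)%E.
  by apply: eq_integral => x _; rewrite expr2.
(* Orthonormality concerns the [fine] part, which is 0 for infinite values; the value 1 thus forces
   a finite integral. *)
by case: (integral _ _ _) => [r /= ->|/= /eqP|/= /eqP] //; rewrite eq_sym oner_eq0.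
Qed.

End MomentProblem.

(** * From pointwise domination to property (cs) *)

Section PropertyCS.
Variable R : realType.
Variable b : nat -> R.
Variable mu : probability (measurableTypeR R) R.
Hypothesis smp : solves_moment_problem b mu.

(** The index n depends on x, so the single term is replaced by the sum over all n. As the integral
    of P_n^2 is 1, integration gives c_2k s_2k <= C q^k / (1 - w), which is summable in k. *)
Lemma property_cs_of_dominated (C q w : R) : 0 < C -> 0 < q < 1 -> 0 < w < 1 ->
  (forall k x, exists n, coef_norm b k.*2 * x ^+ k.*2 <=
     C * q ^+ k * (w ^+ n * (orthopoly b n).[x] ^+ 2)) ->
  property_cs b mu.
Proof.
move=> C0 /andP[q0 q1] /andP[w0 w1] h.
have ck k : 0 <= coef_norm b k by exact: sqrtr_ge0.
have mP n : measurable_fun [set: measurableTypeR R] (fun x => (orthopoly b n).[x] ^+ 2).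
  by apply: measurable_funX; exact: measurable_horner.
have key k : coef_norm b k.*2 * moment mu k.*2 <= C / (1 - w) * q ^+ k.
  have Cq0 : 0 <= C * q ^+ k by rewrite mulr_ge0 ?exprn_ge0 ?(ltW C0) ?(ltW q0).
  rewrite -lee_fin EFinM -(integral_moment smp) -integralZl//; last exact: (smp_moments smp).
  have -> : (C / (1 - w) * q ^+ k)%:E = (\sum_(n <oo) (C * q ^+ k * w ^+ n)%:E)%E.
    have := @cvg_geometric_series R (C * q ^+ k) w.
    rewrite ger0_norm ?(ltW w0)// => /(_ w1) /(cvg_lim (@Rhausdorff _)) hl.
    rewrite mulrAC -hl -EFin_lim; last by apply: is_cvg_geometric_series; rewrite ger0_norm// ltW.
    by apply/congr_lim/funext => n /=; rewrite /series/= sumEFin.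
  have -> : (\sum_(n <oo) (C * q ^+ k * w ^+ n)%:E)%E =
      (\sum_(n <oo) \int[mu]_x (C * q ^+ k * w ^+ n * (orthopoly b n).[x] ^+ 2)%:E)%E.
    apply: eq_eseriesr => n _; under eq_integral do rewrite EFinM.
    rewrite ge0_integralZl_EFin//; last 3 first.
    - by move=> x _; rewrite lee_fin sqr_ge0.
    - exact/measurable_EFinP.
    - by rewrite mulr_ge0// exprn_ge0// ltW.
    by rewrite integral_orthopoly_sqr// mule1.
  rewrite -integral_nneseries//; last 2 first.
  - move=> n; apply/measurable_EFinP; exact: measurable_funM.
  - by move=> n x _; rewrite lee_fin mulr_ge0 ?sqr_ge0// mulr_ge0// exprn_ge0// ltW.
  apply: ge0_le_integral => //.
  - by move=> x _; rewrite -EFinM lee_fin mulr_ge0// -mul2n exprM exprn_ge0// sqr_ge0.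
  - apply/measurable_EFinP; apply: measurable_funM => //; exact: measurable_funX.
  - apply: ge0_emeasurable_sum => [n x _ _|n _].
      by rewrite lee_fin mulr_ge0 ?sqr_ge0// mulr_ge0// exprn_ge0// ltW.
    by apply/measurable_EFinP; exact: measurable_funM.
  move=> x _; have [n hn] := h k x.
  rewrite -EFinM (@le_trans _ _ (C * q ^+ k * w ^+ n * (orthopoly b n).[x] ^+ 2)%:E)//.
    by rewrite lee_fin -mulrA.
  pose u n := (C * q ^+ k * w ^+ n * (orthopoly b n).[x] ^+ 2)%:E.
  have u0 m : (0 <= u m)%E by rewrite lee_fin mulr_ge0 ?sqr_ge0// mulr_ge0// exprn_ge0// ltW.
  apply: le_trans (nneseries_lim_ge n.+1 (fun m _ _ => u0 m)).
  by rewrite big_nat_recr//= leeDr// sume_ge0.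
apply: (@series_le_cvg _ _ (geometric (C / (1 - w)) q)) => //.
- by move=> n; rewrite mulr_ge0// moment_even_ge0.
- by move=> n; rewrite /geometric/= mulr_ge0 ?exprn_ge0 ?(ltW q0)// divr_ge0 ?(ltW C0)// subr_ge0 ltW.
- by apply: is_cvg_geometric_series; rewrite ger0_norm// ltW.
Qed.

Lemma not_property_cs_of_dominated (C : R) : 0 < C ->
  (forall n x, exists m, (orthopoly b n).[x] ^+ 2 <=
     C * \sum_(k < m.+1) coef_norm b k.*2 * x ^+ k.*2) ->
  (forall x, (fun n => (orthopoly b n).[x] ^+ 2) @ \oo --> (0 : R)) ->
  ~ property_cs b mu.
Proof.
move=> C0 h h0 cs.
have ck k : 0 <= coef_norm b k by exact: sqrtr_ge0.
have t0 k x : 0 <= coef_norm b k.*2 * x ^+ k.*2.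
  by rewrite mulr_ge0// -mul2n exprM exprn_ge0// sqr_ge0.
have mt k : measurable_fun [set: measurableTypeR R]
    (fun x => (coef_norm b k.*2 * x ^+ k.*2)%:E).
  apply/measurable_EFinP; apply: measurable_funM => //; exact: measurable_funX.
pose Phi (x : measurableTypeR R) := (\sum_(k <oo) (coef_norm b k.*2 * x ^+ k.*2)%:E)%E.
have Phi0 x : (0 <= Phi x)%E by apply: nneseries_ge0 => k _ _; rewrite lee_fin.
have mPhi : measurable_fun setT Phi.
  by apply: ge0_emeasurable_sum => // k x _ _; rewrite lee_fin.
(* By monotone convergence the integral of Phi is the sum of the c_2k s_2k, finite under (cs). *)
have iPhi : mu.-integrable setT Phi.
  apply/integrableP; split => //.
  under eq_integral do rewrite gee0_abs//.
  rewrite /Phi integral_nneseries//; last by move=> k x _; rewrite lee_fin.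
  rewrite (eq_eseriesr (g := fun k => (coef_norm b k.*2 * moment mu k.*2)%:E)); last first.
    move=> k _; under eq_integral do rewrite EFinM.
    by rewrite integralZl ?(integral_moment smp)//; exact: (smp_moments smp).
  have -> : (\sum_(k <oo) (coef_norm b k.*2 * moment mu k.*2)%:E)%E =
     (limn (series (fun n => coef_norm b n.*2 * moment mu n.*2)))%:E.
    rewrite -EFin_lim//; apply/congr_lim/funext => n /=.
    by rewrite /series/= sumEFin.
  exact: ltry.
have iCPhi : mu.-integrable setT (fun x => (C%:E * Phi x)%E) by exact: integrableZl.
have [|||||_ _] := @dominated_convergence _ _ _ mu setT measurableT
  (fun n x => ((orthopoly b n).[x] ^+ 2)%:E) (cst 0%E) (fun x => (C%:E * Phi x)%E).
- move=> n; apply/measurable_EFinP; apply: measurable_funX; exact: measurable_horner.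
- exact: measurable_cst.
- by apply: aeW => x _; apply: cvg_EFin; [exact: nearW|exact: h0].
- exact: iCPhi.
- apply: aeW => x n _; rewrite gee0_abs ?lee_fin ?sqr_ge0//.
  have [m hm] := h n x; apply: (@le_trans _ _ (C%:E *
     (\sum_(k < m.+1) coef_norm b k.*2 * x ^+ k.*2)%:E)%E).
    by rewrite -EFinM lee_fin.
  rewrite lee_pmul2l// ?lte_fin// -sumEFin.
  rewrite -(big_mkord xpredT (fun k => (coef_norm b k.*2 * x ^+ k.*2)%:E)).
  by apply: nneseries_lim_ge => k _ _; rewrite lee_fin.
(* The integrals of P_n^2 are constantly 1 but would have to tend to 0. *)
rewrite integral_cst// mul0e.
under eq_fun do rewrite integral_orthopoly_sqr//.
move=> /(cvg_lim (@ereal_hausdorff R)); rewrite lim_cst; last exact: ereal_hausdorff.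
by move=> /eqP; rewrite onee_eq0.
Qed.

End PropertyCS.

Theorem theorem7p3 (R : realType) (c : R)
    (mu : probability (measurableTypeR R) R) :
  1 < c ->
  solves_moment_problem (power_coef c) mu ->
  (3 / 2 < c -> property_cs (power_coef c) mu) /\
  (c < 3 / 2 -> ~ property_cs (power_coef c) mu).
Proof.
move=> c_gt1 smp; split=> hc.
  have [C [q [w [C0 hq hw h]]]] := coef_norm_dominated c_gt1 hc.
  exact: (property_cs_of_dominated smp C0 hq hw h).
have [C C0 h] := orthopoly_dominated c_gt1 hc.
exact: (not_property_cs_of_dominated smp C0 h (orthopoly_cvg0 c_gt1)).
Qed.
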